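(* Let $F\in\mathcal C_{+1}$ and let $M$ be an object of $\mathcal C=\langle M_1,\dots,M_n\rangle$. Then the canonical algebra homomorphism $$\Phi_F(M):K\mathrm{Aut}_{\mathcal C_{+1}}(F)\to \mathrm{End}_{\mathrm{Aut}_R(M)}\bigl(\overline{KF(M)}\bigr),$$ which sends a group element $\alpha\in \mathrm{Aut}_{\mathcal C_{+1}}(F)$ to the restriction to $\overline{KF(M)}$ of the map $\alpha_*:KF(M)\to KF(M)$, $\alpha_*(u_m)=u_{\alpha_M(m)}$, is surjective. If $M$ is large enough, then $\Phi_F(M)$ is also injective; that is, there is a constant $c>0$ such that $\Phi_F(M)$ is injective whenever $M=\bigoplus_{i=1}^n M_i^{a_i}$ with $a_i>c$ for every $i$.
   Context: Let $\mathfrak o$ be a complete discrete valuation ring with uniformiser $\pi$ and finite residue field, $\ell\ge 1$, $\mathfrak o_\ell=\mathfrak o/\pi^\ell$. $R$ is a finite (not necessarily commutative) $\mathfrak o_\ell$-algebra, modules are left modules, and $K$ is an algebraically closed field of characteristic $0$. $M_1,\dots,M_n$ are pairwise non-isomorphic finite indecomposable $R$-modules. $\mathcal C=\langle M_1,\dots,M_n\rangle$ is the full subcategory of $R$-modules of the form $\bigoplus_i M_i^{b_i}$, $b_i\in\mathbb Z_{\ge0}$. $\mathcal C_{+1}$ is the (abelian) category of $\mathfrak o_\ell$-linear functors from $\mathcal C$ to finite $\mathfrak o_\ell$-modules. For $F\in\mathcal C_{+1}$ and $M\in\mathcal C$, $KF(M)$ is the $K$-vector space with basis $\{u_m\mid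 m\in F(M)\}$, a permutation representation of $\mathrm{Aut}_R(M)$ via $g\cdot u_m=u_{F(g)(m)}$. $G\prec F$ means that $G$ is isomorphic to a subquotient of $F$ and $G\not\cong F$. $\overline{KF(M)}$ is the largest subrepresentation of $KF(M)$ with the property that $\mathrm{Hom}_{\mathrm{Aut}_R(M)}(KG(M),\overline{KF(M)})=0$ for every $G\prec F$. *)

(* Defs.v *)
From HB Require Import structures.
From mathcomp Require Import all_boot all_order all_algebra all_fingroup.
From mathcomp Require Import ring_quotient finmap monalg boolp.
Set Implicit Arguments. Unset Strict Implicit. Unset Printing Implicit Defensive.
Import GRing.Theory.
Local Open Scope ring_scope.

(* A domain is a discrete valuation ring with uniformiser pi exactly when
   every nonzero element is a unit times a power of the nonzero nonunit pi. *)
Record complete_dvr (o : idomainType) (pi : o) : Prop := CompleteDvr {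
  uniformiser_neq0 : pi != 0;
  uniformiser_nunit : pi \isn't a GRing.unit;
  uniformiser_factor : forall x : o, x != 0 ->
    exists2 u : o, u \is a GRing.unit & exists k : nat, x = u * pi ^+ k;
  dvr_complete : forall s : nat -> o,
    (forall k, exists y, s k.+1 - s k = pi ^+ k * y) ->
    exists x, forall k, exists y, x - s k = pi ^+ k * y;
  dvr_finite_residue : exists r : seq o,
    forall x : o, exists2 y, y \in r & exists z, x - y = pi * z
}.

Section Truncation.
Variables (o : idomainType) (pi : o).

(* The two proofs are arguments so that the ideal can be declared proper. *)
Definition pi_ideal (ell : nat) of complete_dvr pi & (0 < ell)%N : o -> bool :=
  fun x => `[< exists y, x = pi ^+ ell * y >].

Lemma pi_ideal_closed ell (Ho : complete_dvr pi) (ell_gt0 : (0 < ell)%N) :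
  idealr_closed (pi_ideal Ho ell_gt0).
Proof.
split; first by apply/asboolP; exists 0; rewrite mulr0.
  apply/asboolP=> -[y]; case: ell ell_gt0 => // l _.
  rewrite exprS -mulrA => e.
  have := uniformiser_nunit Ho.
  by case/negP; apply/unitrPr; exists (pi ^+ l * y).
move=> a x y /asboolP[x' ->] /asboolP[y' ->]; apply/asboolP.
by exists (a * x' + y'); rewrite mulrDr mulrCA.
Qed.

HB.instance Definition _ ell (Ho : complete_dvr pi) (ell_gt0 : (0 < ell)%N) :=
  isIdealr.Build o (pi_ideal Ho ell_gt0) (pi_ideal_closed Ho ell_gt0).

Definition truncation ell (Ho : complete_dvr pi) (ell_gt0 : (0 < ell)%N) :
  comNzRingType := {ideal_quot (pi_ideal Ho ell_gt0 : idealr o)}.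

End Truncation.

Section DirectSum.
Variables (R : nzRingType) (I : finType) (T : I -> finLmodType R).

Definition dsum := {dffun forall k : I, T k}.
HB.instance Definition _ := Finite.on dsum.
Implicit Types x y z : dsum.

Definition dsum_zero : dsum := [ffun k : I => 0 : T k].
Definition dsum_opp x : dsum := [ffun k : I => - x k].
Definition dsum_add x y : dsum := [ffun k : I => x k + y k].
Definition dsum_scale (a : R) x : dsum := [ffun k : I => a *: x k].

Lemma dsum_addA : associative dsum_add.
Proof. by move=> x y z; apply/ffunP=> k; rewrite !ffunE addrA. Qed.
Lemma dsum_addC : commutative dsum_add.
Proof. by move=> x y; apply/ffunP=> k; rewrite !ffunE addrC. Qed.
Lemma dsum_add0 : left_id dsum_zero dsum_add.
Proof. by move=> x; apply/ffunP=> k; rewrite !ffunE add0r. Qed.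
Lemma dsum_addN : left_inverse dsum_zero dsum_opp dsum_add.
Proof. by move=> x; apply/ffunP=> k; rewrite !ffunE addNr. Qed.
HB.instance Definition _ :=
  GRing.isZmodule.Build dsum dsum_addA dsum_addC dsum_add0 dsum_addN.

Lemma dsum_scaleA a b x :
  dsum_scale a (dsum_scale b x) = dsum_scale (a * b) x.
Proof. by apply/ffunP=> k; rewrite !ffunE scalerA. Qed.
Lemma dsum_scale1 : left_id 1 dsum_scale.
Proof. by move=> x; apply/ffunP=> k; rewrite !ffunE scale1r. Qed.
Lemma dsum_scaleDr : right_distributive dsum_scale +%R.
Proof. by move=> a x y; apply/ffunP=> k; rewrite !ffunE scalerDr. Qed.
Lemma dsum_scaleDl x : {morph dsum_scale^~ x : a b / a + b}.
Proof. by move=> a b; apply/ffunP=> k; rewrite !ffunE scalerDl. Qed.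
HB.instance Definition _ := GRing.Zmodule_isLmodule.Build R dsum
  dsum_scaleA dsum_scale1 dsum_scaleDr dsum_scaleDl.

End DirectSum.

Definition isomorphic (R : nzRingType) (U V : lmodType R) : Prop :=
  exists f : {linear U -> V}, bijective f.

Definition indecomposable (R : nzRingType) (N : finLmodType R) : Prop :=
  (exists x : N, x != 0) /\
  forall U V : finLmodType R, isomorphic (U * V)%type N ->
    (forall u : U, u = 0) \/ (forall v : V, v = 0).

Lemma linear_ext (R : nzRingType) (U V : lmodType R) (f g : {linear U -> V}) :
  f =1 g -> f = g.
Proof.
case: f g => [f cf] [g cg] /= /funext fg; subst g; congr (GRing.Linear.Pack _).
case: cf cg => [[a] [b]] [[c] [d]].
by rewrite (Prop_irrelevance a c) (Prop_irrelevance b d).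
Qed.

Section GroupAlgebra.
Variables (K : fieldType) (G : groupType).

(* The multiplication that monalg puts on {malg K[G]} requires a monoid
   without nontrivial units, so only its module structure is reused. *)
Definition group_algebra : Type := {malg K[G]}.
HB.instance Definition _ := GRing.Lmodule.copy group_algebra {malg K[G]}.

Definition ga_coef (x : group_algebra) (g : G) : K := (x : {malg K[G]})@_g.
Definition ga_supp (x : group_algebra) : seq G := msupp (x : {malg K[G]}).
Definition ga_elt (g : G) : group_algebra := << g >>.

Definition ga_ext (V : lmodType K) (f : G -> V) (x : group_algebra) : V :=
  \sum_(g <- ga_supp x) ga_coef x g *: f g.

Section Extension.
Variables (V : lmodType K) (f : G -> V).

Lemma ga_ext_sub (s : seq G) x :
  uniq s -> {subset ga_supp x <= s} ->
  ga_ext f x = \sum_(g <- s) ga_coef x g *: f g.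
Proof.
move=> us sub; rewrite (bigID (mem (ga_supp x))) /= [X in _ + X]big1 ?addr0.
  rewrite -big_filter; apply: perm_big; apply: uniq_perm.
  - exact: fset_uniq.
  - exact: filter_uniq.
  - move=> g; rewrite mem_filter /=.
    by case: (boolP (g \in ga_supp x)) => // /sub ->.
move=> g gN; rewrite /ga_coef mcoeff_outdom ?scale0r //.
Qed.

Lemma ga_ext_is_linear : linear (ga_ext f).
Proof.
move=> a x y.
pose s := undup (ga_supp (a *: x + y) ++ ga_supp x ++ ga_supp y).
rewrite !(@ga_ext_sub s) ?undup_uniq //; try by
  move=> g gs; rewrite mem_undup !mem_cat gs ?orbT.
rewrite scaler_sumr -big_split /=; apply: eq_bigr => g _.
by rewrite scalerA -scalerDl /ga_coef mcoeffD mcoeffZ.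
Qed.
HB.instance Definition _ :=
  GRing.isLinear.Build K group_algebra V _ (ga_ext f) ga_ext_is_linear.

Lemma ga_ext_elt g : ga_ext f (ga_elt g) = f g.
Proof.
by rewrite /ga_ext /ga_supp msuppU oner_eq0 big_seq_fset1 /ga_coef mcoeffUU scale1r.
Qed.

End Extension.

Lemma ga_sum x : x = \sum_(g <- ga_supp x) ga_coef x g *: ga_elt g.
Proof.
rewrite {1}[x]monalgE; apply: eq_bigr => g _.
by apply/malgP => h; rewrite mcoeffZ !mcoeffU mulr_natr.
Qed.

Lemma ga_linear_eq (V : lmodType K) (f1 f2 : {linear group_algebra -> V}) :
  (forall g, f1 (ga_elt g) = f2 (ga_elt g)) -> f1 =1 f2.
Proof.
move=> e x; rewrite (ga_sum x) !linear_sum; apply: eq_bigr => g _.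
by rewrite !linearZ /= e.
Qed.

Definition ga_mul (x y : group_algebra) : group_algebra :=
  ga_ext (fun g => ga_ext (fun h => ga_elt (g * h)%g) y) x.

Lemma ga_mul_eltl g y : ga_mul (ga_elt g) y = ga_ext (fun h => ga_elt (g * h)%g) y.
Proof. exact: ga_ext_elt. Qed.

Lemma ga_mul_elt g h : ga_mul (ga_elt g) (ga_elt h) = ga_elt (g * h)%g.
Proof. by rewrite ga_mul_eltl ga_ext_elt. Qed.

Definition ga_mulr y x := ga_mul x y.

Lemma ga_mul_linearl y : linear (ga_mulr y).
Proof. by move=> a x z; rewrite /ga_mulr /ga_mul linearP. Qed.

Lemma ga_mul_linearr x : linear (ga_mul x).
Proof.
move=> a y z; rewrite /ga_mul /ga_ext scaler_sumr -big_split /=.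
apply: eq_bigr => g _.
rewrite -/(ga_ext _ (a *: y + z)) linearP scalerDr.
by rewrite !scalerA mulrC.
Qed.

HB.instance Definition _ y := GRing.isLinear.Build K group_algebra group_algebra
  _ (ga_mulr y) (ga_mul_linearl y).
HB.instance Definition _ x := GRing.isLinear.Build K group_algebra group_algebra
  _ (ga_mul x) (ga_mul_linearr x).

Lemma ga_mulA : associative ga_mul.
Proof.
move=> x y z.
have e := @ga_linear_eq group_algebra.
apply: (e (ga_mulr (ga_mul y z)) (ga_mulr z \o ga_mulr y) _ x) => g /=.
apply: (e (ga_mul (ga_elt g) \o ga_mulr z)
  (ga_mulr z \o ga_mul (ga_elt g)) _ y) => h /=.
apply: (e (ga_mul (ga_elt g) \o ga_mul (ga_elt h))
  (ga_mul (ga_mul (ga_elt g) (ga_elt h))) _ z) => k /=.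
by rewrite /ga_mulr !ga_mul_elt mulgA.
Qed.

Lemma ga_mul1 : left_id (ga_elt 1%g) ga_mul.
Proof.
move=> x; apply: (@ga_linear_eq _ (ga_mul (ga_elt 1%g)) idfun _ x) => g /=.
by rewrite ga_mul_elt mul1g.
Qed.

Lemma ga_mulr1 : right_id (ga_elt 1%g) ga_mul.
Proof.
move=> x; apply: (@ga_linear_eq _ (ga_mulr (ga_elt 1%g)) idfun _ x) => g /=.
by rewrite /ga_mulr ga_mul_elt mulg1.
Qed.

Lemma ga_mulDl : left_distributive ga_mul +%R.
Proof. by move=> x y z; apply: (raddfD (ga_mulr z)). Qed.
Lemma ga_mulDr : right_distributive ga_mul +%R.
Proof. by move=> x y z; rewrite (raddfD (ga_mul x)). Qed.

Lemma ga_elt1_neq0 : ga_elt 1%g != 0.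
Proof. by rewrite monalgU_eq0 oner_eq0. Qed.

HB.instance Definition _ := GRing.Zmodule_isNzRing.Build group_algebra
  ga_mulA ga_mul1 ga_mulr1 ga_mulDl ga_mulDr ga_elt1_neq0.

Lemma ga_scaleAl (a : K) (x y : group_algebra) : a *: (x * y) = (a *: x) * y.
Proof. exact/esym/(linearZ_LR (ga_mulr y)). Qed.
HB.instance Definition _ :=
  GRing.Lmodule_isLalgebra.Build K group_algebra ga_scaleAl.

Lemma ga_scaleAr (a : K) (x y : group_algebra) : a *: (x * y) = x * (a *: y).
Proof. exact/esym/(linearZ_LR (ga_mul x)). Qed.
HB.instance Definition _ :=
  GRing.Lalgebra_isAlgebra.Build K group_algebra ga_scaleAr.

End GroupAlgebra.

Section FunctorCategory.
Variables (A : comNzRingType) (R : finAlgType A).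
Variables (n : nat) (M : 'I_n -> finLmodType R).

(* Objects are multiplicities: b stands for the direct sum of b i copies of
   each M i, that is for obj_mod b. *)
Definition obj := 'I_n -> nat.
Definition obj_mod (b : obj) : finLmodType R :=
  dsum (fun k : {i : 'I_n & 'I_(b i)} => M (tag k)).
Definition hom (b c : obj) := {linear obj_mod b -> obj_mod c}.

(* Hom sets are A-modules through the structure map k |-> k%:A of R; since
   f = 1 *: f + 0, the last field also makes fmap f depend only on the values
   of f. *)
Record lin_functor := LinFunctor {
  fobj :> obj -> finLmodType A;
  fmap : forall b c, hom b c -> {linear fobj b -> fobj c};
  fmap_id : forall b x, fmap (idfun : hom b b) x = x;
  fmap_comp : forall b c d (g : hom c d) (f : hom b c) x,
    fmap (g \o f : hom b d) x = fmap g (fmap f x);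
  fmap_linear : forall b c (k : A) (f g h : hom b c),
    (forall x, h x = k%:A *: f x + g x) ->
    forall y, fmap h y = k *: fmap f y + fmap g y
}.

Record nat_trans (F G : lin_functor) := NatTrans {
  nt_comp :> forall b, {linear F b -> G b};
  nt_natural : forall b c (f : hom b c) x,
    nt_comp c (fmap F f x) = fmap G f (nt_comp b x)
}.

Lemma nat_trans_ext F G (s t : nat_trans F G) : (forall b, s b =1 t b) -> s = t.
Proof.
case: s t => [s ns] [t nt] /= e.
have st : s = t.
  by apply: functional_extensionality_dep => b; apply: (linear_ext (e b)).
by clear e; subst t; congr NatTrans; apply: Prop_irrelevance.
Qed.

Definition nt_id F : nat_trans F F :=
  @NatTrans F F (fun b => idfun) (fun b c f x => erefl).

Lemma nt_trans_subproof F G H (t : nat_trans G H) (s : nat_trans F G)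
  b c (f : hom b c) x : t c (s c (fmap F f x)) = fmap H f (t b (s b x)).
Proof. by rewrite !nt_natural. Qed.
Definition nt_trans F G H (t : nat_trans G H) (s : nat_trans F G) :
  nat_trans F H :=
  @NatTrans F H (fun b => t b \o s b) (@nt_trans_subproof F G H t s).

Definition functor_iso (F G : lin_functor) : Prop :=
  exists (s : nat_trans F G) (t : nat_trans G F),
    nt_trans t s = nt_id F /\ nt_trans s t = nt_id G.

(* G is a quotient of the subobject H of F; kernels and cokernels are computed
   objectwise, so monomorphisms and epimorphisms are objectwise injections and
   surjections. *)
Definition subquotient (G F : lin_functor) : Prop :=
  exists (H : lin_functor) (i : nat_trans H F) (p : nat_trans H G),
    (forall b, injective (i b)) /\ (forall b y, exists x, p b x = y).

Definition prec (G F : lin_functor) : Prop :=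
  subquotient G F /\ ~ functor_iso G F.

Record functor_aut (F : lin_functor) := FunctorAut {
  aut_fun :> nat_trans F F;
  aut_inv : nat_trans F F;
  aut_invK : nt_trans aut_inv aut_fun = nt_id F;
  aut_funK : nt_trans aut_fun aut_inv = nt_id F
}.

Section AutomorphismGroup.
Variable F : lin_functor.
Implicit Types s t : functor_aut F.

Lemma aut_funVK s b : cancel (s b) (aut_inv s b).
Proof.
by move=> x; have /(congr1 (fun t : nat_trans F F => t b x)) := aut_invK s.
Qed.

Lemma aut_invVK s b : cancel (aut_inv s b) (s b).
Proof.
by move=> x; have /(congr1 (fun t : nat_trans F F => t b x)) := aut_funK s.
Qed.

Lemma functor_aut_ext s t : (forall b, s b =1 t b) -> s = t.
Proof.
move=> st; have fe : aut_fun s = aut_fun t by apply: nat_trans_ext.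
have ie : aut_inv s = aut_inv t.
  apply: nat_trans_ext => b x.
  by rewrite -{1}[x](aut_invVK t) -st aut_funVK.
case: s t fe ie {st} => [s s' s1 s2] [t t' t1 t2] /= fe ie; subst t t'.
by congr FunctorAut; apply: Prop_irrelevance.
Qed.

Lemma aut_mul_subproof s t :
  nt_trans (nt_trans (aut_inv t) (aut_inv s)) (nt_trans s t) = nt_id F.
Proof. by apply: nat_trans_ext => b x /=; rewrite !aut_funVK. Qed.
Lemma aut_mul_subproof' s t :
  nt_trans (nt_trans s t) (nt_trans (aut_inv t) (aut_inv s)) = nt_id F.
Proof. by apply: nat_trans_ext => b x /=; rewrite !aut_invVK. Qed.
Lemma aut_one_subproof : nt_trans (nt_id F) (nt_id F) = nt_id F.
Proof. by apply: nat_trans_ext. Qed.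

Definition aut_mul s t :=
  FunctorAut (aut_mul_subproof s t) (aut_mul_subproof' s t).
Definition aut_one := FunctorAut aut_one_subproof aut_one_subproof.
Definition aut_invg s := FunctorAut (aut_funK s) (aut_invK s).

Lemma aut_mulA : associative aut_mul.
Proof. by move=> s t u; apply: functor_aut_ext. Qed.
Lemma aut_mul1 : left_id aut_one aut_mul.
Proof. by move=> s; apply: functor_aut_ext. Qed.
Lemma aut_mulr1 : right_id aut_one aut_mul.
Proof. by move=> s; apply: functor_aut_ext. Qed.
Lemma aut_mulV : left_inverse aut_one aut_invg aut_mul.
Proof. by move=> s; apply: functor_aut_ext => b x /=; rewrite aut_funVK. Qed.
Lemma aut_mulrV : right_inverse aut_one aut_invg aut_mul.
Proof. by move=> s; apply: functor_aut_ext => b x /=; rewrite aut_invVK. Qed.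

HB.instance Definition _ := gen_eqMixin (functor_aut F).
HB.instance Definition _ := gen_choiceMixin (functor_aut F).
HB.instance Definition _ := isGroup.Build (functor_aut F)
  aut_mulA aut_mul1 aut_mulr1 aut_mulV aut_mulrV.

End AutomorphismGroup.

End FunctorCategory.

Section PermutationModules.
Variable K : fieldType.

Definition ubasis (X : finType) (x : X) : {ffun X -> K^o} :=
  [ffun y => (y == x)%:R].

Definition push_fun (X Y : finType) (h : X -> Y) (v : {ffun X -> K^o}) :
  {ffun Y -> K^o} := \sum_x v x *: ubasis (h x).

Lemma push_fun_is_linear (X Y : finType) (h : X -> Y) : linear (push_fun h).
Proof.
move=> a u w; rewrite scaler_sumr -big_split /=; apply: eq_bigr => x _.
by rewrite !ffunE scalerA -scalerDl.
Qed.
HB.instance Definition _ (X Y : finType) (h : X -> Y) :=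
  GRing.isLinear.Build K {ffun X -> K^o} {ffun Y -> K^o} _ (push_fun h)
    (push_fun_is_linear h).

(* The linear map u_x |-> u_(h x); see push_ubasis. *)
Definition push (X Y : finType) (h : X -> Y) :
    'Hom({ffun X -> K^o}, {ffun Y -> K^o}) :=
  linfun (push_fun h).

Lemma pushE (X Y : finType) (h : X -> Y) v :
  push h v = \sum_x v x *: ubasis (h x).
Proof. by rewrite lfunE. Qed.

Lemma ubasis_sum (X : finType) (v : {ffun X -> K^o}) :
  v = \sum_x v x *: ubasis x.
Proof.
apply/ffunP=> y; rewrite sum_ffunE (bigD1 y) //= !ffunE eqxx [_ *: _]mulr1 big1 ?addr0 //.
by move=> x /negPf xy; rewrite !ffunE eq_sym xy scaler0.
Qed.

Lemma push_ubasis (X Y : finType) (h : X -> Y) x :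
  push h (ubasis x) = ubasis (h x).
Proof.
rewrite pushE (bigD1 x) //= ffunE eqxx scale1r big1 ?addr0 //.
by move=> y /negPf yx; rewrite ffunE yx scale0r.
Qed.

Lemma lfun_ubasis_ext (X : finType) (V : vectType K)
  (f g : 'Hom({ffun X -> K^o}, V)) : (forall x, f (ubasis x) = g (ubasis x)) -> f = g.
Proof.
move=> e; apply/lfunP=> v; rewrite (ubasis_sum v) !linear_sum.
by apply: eq_bigr => x _; rewrite !linearZ; congr (_ *: _); apply: e.
Qed.

Lemma push_comp (X Y Z : finType) (h : Y -> Z) (k : X -> Y) v :
  push h (push k v) = push (h \o k) v.
Proof.
rewrite -comp_lfunE; congr (fun_of_lfun _ v); apply: lfun_ubasis_ext => x.
by rewrite comp_lfunE !push_ubasis.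
Qed.

Lemma push_id (X : finType) (h : X -> X) v : h =1 id -> push h v = v.
Proof.
move=> e; rewrite -[RHS]id_lfunE; congr (fun_of_lfun _ v).
by apply: lfun_ubasis_ext => x; rewrite push_ubasis id_lfunE e.
Qed.

Lemma eq_push (X Y : finType) (h k : X -> Y) v : h =1 k -> push h v = push k v.
Proof.
move=> e; congr (fun_of_lfun _ v); apply: lfun_ubasis_ext => x.
by rewrite !push_ubasis e.
Qed.

End PermutationModules.

Section Representations.
Variables (K : fieldType) (charK : [pchar K] =i pred0).
Variables (A : comNzRingType) (R : finAlgType A).
Variables (n : nat) (M : 'I_n -> finLmodType R).
Implicit Types (F G : lin_functor M) (b : obj n).

Definition KF F b : vectType K := {ffun F b -> K^o}.

(* Throughout, the automorphisms of b are the bijective g : hom M b b, since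
   the inverse of a bijective linear map is linear. *)
Definition act F b (g : hom M b b) : 'End(KF F b) := push K (fmap F g).

Definition equivariant F G b (f : 'Hom(KF F b, KF G b)) : Prop :=
  forall g : hom M b b, bijective g -> (f \o act F g = act G g \o f)%VF.

Definition subrep F b (V : {vspace KF F b}) : Prop :=
  forall g : hom M b b, bijective g -> (act F g @: V <= V)%VS.

Definition no_prec_hom F b (V : {vspace KF F b}) : Prop :=
  forall G, prec G F ->
  forall f : 'Hom(KF G b, KF F b), equivariant f -> (limg f <= V)%VS -> f = 0.

Definition largest_rep F b (V : {vspace KF F b}) : Prop :=
  [/\ subrep V, no_prec_hom V &
      forall W : {vspace KF F b}, subrep W -> no_prec_hom W -> (W <= V)%VS].

Section Averaging.
Variable b : obj n.
Local Notation X := (obj_mod M b).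

Let S : {set {perm X}} := 
  [set s : {perm X} | `[< exists g : hom M b b, g =1 s >]].

Let L (s : {perm X}) : hom M b b :=
  if pselect (exists g : hom M b b, g =1 s) is left e then sval (cid e)
  else idfun.

Let LE s : s \in S -> L s =1 s.
Proof.
rewrite inE => /asboolP e; rewrite /L; case: pselect => // e'.
by case: cid.
Qed.

Let L_bij s : s \in S -> bijective (L s).
Proof.
move=> /LE e; exists (s^-1)%g => x; first by rewrite e permK.
by rewrite e permKV.
Qed.

Let S1 : (1%g : {perm X}) \in S.
Proof. by rewrite inE; apply/asboolP; exists idfun => x; rewrite perm1. Qed.

Let SM s t : s \in S -> t \in S -> (s * t)%g \in S.
Proof.
move=> Ss St; rewrite inE; apply/asboolP; exists (L t \o L s) => x /=.
by rewrite !LE // permM.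
Qed.

Let SV s : s \in S -> (s^-1)%g \in S.
Proof.
move=> Ss; suff -> : (s^-1 = s ^+ #[s].-1)%g.
  by elim: (_.-1) => [|k IH]; rewrite ?expg0 // expgS SM.
by rewrite invg_expg.
Qed.

Let Sg (g : hom M b b) : bijective g -> exists2 s, s \in S & L s = g.
Proof.
move=> /bij_inj gi; have Ss : perm gi \in S.
  by rewrite inE; apply/asboolP; exists g => x; rewrite permE.
by exists (perm gi) => //; apply: linear_ext => x; rewrite LE // permE.
Qed.

Let actM F s t v : s \in S -> t \in S ->
  act F (L (s * t)%g) v = act F (L t) (act F (L s) v).
Proof.
move=> Ss St; have -> : L (s * t)%g = (L t \o L s : hom M b b).
  by apply: linear_ext => x; rewrite /= !LE ?SM // permM.
by rewrite /act push_comp; apply: eq_push => x /=; rewrite fmap_comp.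
Qed.

Let act1 F v : act F (L 1%g) v = v.
Proof.
have -> : L 1%g = (idfun : hom M b b).
  by apply: linear_ext => x; rewrite /= LE // perm1.
by rewrite /act push_id // => x; rewrite fmap_id.
Qed.

Let actVK F s v : s \in S -> act F (L s) (act F (L s^-1%g) v) = v.
Proof. by move=> Ss; rewrite -actM ?SV // mulVg act1. Qed.

Let avg F G (f : 'Hom(KF F b, KF G b)) : 'Hom(KF F b, KF G b) :=
  (#|S|%:R)^-1 *:
    \sum_(s in S) (act G (L s^-1%g) \o f \o act F (L s))%VF.

Let avgE F G (f : 'Hom(KF F b, KF G b)) v :
  avg f v = (#|S|%:R)^-1 *:
    \sum_(s in S) act G (L s^-1%g) (f (act F (L s) v)).
Proof.
rewrite /avg scale_lfunE sum_lfunE; congr (_ *: _).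
by apply: eq_bigr => s _; rewrite !comp_lfunE.
Qed.

Let avg_equiv F G (f : 'Hom(KF F b, KF G b)) : equivariant (avg f).
Proof.
move=> g /Sg[t St <-]; apply/lfunP=> v; rewrite !comp_lfunE !avgE.
rewrite linearZ; congr (_ *: _); rewrite linear_sum /=.
rewrite (reindex_inj (mulgI t^-1%g)) /=.
rewrite (eq_bigl (mem S)) => [|s]; last first.
  apply/idP/idP => [h|]; last by apply: SM; apply: SV.
  by rewrite -[s](mulKVg t); apply: SM.
apply: eq_bigr => s Ss.
rewrite invMg invgK actM ?SV //; congr (act G _ _); congr (act G _ _).
by rewrite -actM ?SM ?SV // mulKVg.
Qed.

Let subrep_act F (V : {vspace KF F b}) s v :
  subrep V -> s \in S -> v \in V -> act F (L s) v \in V.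
Proof.
by move=> Vi Ss vV; apply: (subvP (Vi _ (L_bij Ss))); apply: memv_img.
Qed.

Let avg_mem F (V : {vspace KF F b}) (f : 'End(KF F b)) v :
  subrep V -> (forall u, f u \in V) -> avg f v \in V.
Proof.
move=> Vi fV; rewrite avgE memvZ // memv_suml // => s Ss.
by apply: subrep_act; rewrite ?SV.
Qed.

Lemma subrepD F (V W : {vspace KF F b}) :
  subrep V -> subrep W -> subrep (V + W)%VS.
Proof. by move=> Vi Wi g gb; rewrite limgD addvS ?Vi ?Wi. Qed.

Lemma no_prec_homD F (V W : {vspace KF F b}) :
  subrep V -> no_prec_hom V -> subrep W -> no_prec_hom W ->
  no_prec_hom (V + W)%VS.
Proof.
move=> Vi Vn Wi Wn G GF f fe fVW.
pose p : 'End(KF F b) := avg (addv_pi1 V W).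
pose q : 'End(KF F b) := avg (addv_pi2 V W).
have pV v : p v \in V by apply: avg_mem => // u; apply: memv_pi1.
have qW v : q v \in W by apply: avg_mem => // u; apply: memv_pi2.
have comp0 (r : 'End(KF F b)) (U : {vspace KF F b}) :
  equivariant r -> no_prec_hom U -> (forall v, r v \in U) -> (r \o f)%VF = 0.
  move=> re Un rU; apply: (Un G GF).
    by move=> g gb; rewrite -comp_lfunA fe // !comp_lfunA re.
  by apply/subvP=> _ /memv_imgP[v _ ->]; rewrite comp_lfunE.
have pf := comp0 p V (avg_equiv _) Vn pV.
have qf := comp0 q W (avg_equiv _) Wn qW.
have S0 : #|S|%:R != 0 :> K.
  rewrite ((pcharf0P K).1 charK) -lt0n; apply/card_gt0P; exists 1%g; exact: S1.
apply/lfunP=> v; rewrite lfunE /=.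
have fv : f v \in (V + W)%VS by apply: (subvP fVW); apply: memv_img; apply: memvf.
have <- : p (f v) + q (f v) = f v.
  rewrite !avgE -scalerDr -big_split /=.
  rewrite (eq_bigr (fun=> f v)) => [|s Ss].
    by rewrite sumr_const -scaler_nat scalerA mulVf ?scale1r.
  rewrite -linearD addv_pi1_pi2; last by apply: subrep_act => //; apply: subrepD.
  by have := actVK (f v) (SV Ss); rewrite invgK.
have /lfunP/(_ v) := pf; have /lfunP/(_ v) := qf.
by rewrite !comp_lfunE !lfunE /= => -> ->; rewrite addr0.
Qed.

End Averaging.

Lemma largest_rep_exists F b : exists V : {vspace KF F b}, largest_rep V.
Proof.
pose P (V : {vspace KF F b}) := subrep V /\ no_prec_hom V.
have P0 : P 0%VS.
  split=> [g gb|G _ f _]; first by rewrite limg0 sub0v.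
  rewrite subv0 => /eqP f0; apply/lfunP=> v; apply/eqP; rewrite lfunE /= -memv0.
  by rewrite -f0 memv_img // memvf.
pose Q d := `[< exists2 V, P V & \dim V = d >].
have Q0 : exists d, Q d by exists 0; apply/asboolP; exists 0%VS; rewrite ?dimv0.
have Qub d : Q d -> (d <= \dim (fullv : {vspace KF F b}))%N.
  by case/asboolP=> V _ <-; apply/dimvS/subvf.
case: (ex_maxnP Q0 Qub) => d /asboolP[V [Vi Vn] <-] Vmax.
exists V; split=> // W Wi Wn.
have VW : P (V + W)%VS by split; [apply: subrepD | apply: no_prec_homD].
have : (V == V + W)%VS.
  by rewrite eqEdim addvSl Vmax //; apply/asboolP; exists (V + W)%VS.
by move=> /eqP ->; apply: addvSr.
Qed.

Definition KFbar F b : {vspace KF F b} := sval (cid (largest_rep_exists F b)).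

Lemma KFbarP F b : largest_rep (KFbar F b).
Proof. exact: svalP (cid (largest_rep_exists F b)). Qed.

Lemma KFbar_act F b (g : hom M b b) v :
  bijective g -> v \in KFbar F b -> act F g v \in KFbar F b.
Proof.
case: (KFbarP F b) => Vi _ _ gb vV.
by apply: (subvP (Vi g gb)); apply: memv_img.
Qed.

Definition aut_act F b (s : functor_aut F) : 'End(KF F b) := push K (s b).

Lemma aut_actM F b (s t : functor_aut F) v :
  aut_act b (s * t)%g v = aut_act b s (aut_act b t v).
Proof. by rewrite /aut_act push_comp; apply: eq_push. Qed.

Lemma aut_act1 F b v : aut_act b (1%g : functor_aut F) v = v.
Proof. exact: push_id. Qed.

Lemma aut_act_equiv F b (s : functor_aut F) : equivariant (aut_act b s).
Proof.
move=> g gb; apply/lfunP=> v; rewrite !comp_lfunE /aut_act /act !push_comp.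
by apply: eq_push => x; apply: nt_natural.
Qed.

Lemma KFbar_aut_act F b (s : functor_aut F) v :
  v \in KFbar F b -> aut_act b s v \in KFbar F b.
Proof.
move=> vV; case: (KFbarP F b) => Vi Vn Vm.
apply: (subvP (Vm (aut_act b s @: KFbar F b)%VS _ _)); last exact: memv_img.
  move=> g gb; rewrite -limg_comp -aut_act_equiv // limg_comp.
  exact/limgS/Vi.
move=> G GF f fe fV.
have sK : cancel (aut_act b s) (aut_act b s^-1%g).
  by move=> u; rewrite -aut_actM mulVg aut_act1.
suff f0 : (aut_act b s^-1%g \o f)%VF = 0.
  apply/lfunP=> u; rewrite lfunE /=.
  have /lfunP/(_ u) := f0; rewrite comp_lfunE [RHS]lfunE /= => e.
  by rewrite -[f u]aut_act1 -(mulgV s) aut_actM e linear0.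
apply: (Vn G GF).
  by move=> g gb; rewrite -comp_lfunA fe // !comp_lfunA aut_act_equiv.
rewrite limg_comp; apply/subvP=> _ /memv_imgP[u /(subvP fV)/memv_imgP[w wV ->] ->].
by rewrite sK.
Qed.

Section Restriction.
Variables (vT : vectType K) (U : {vspace vT}).

Definition restr (f : 'End(vT)) : 'End(subvs_of U) :=
  linfun (vsproj U \o (f \o vsval)).

Lemma restrE (f : 'End(vT)) (u : subvs_of U) :
  (forall v, v \in U -> f v \in U) -> vsval (restr f u) = f (vsval u).
Proof. by move=> fU; rewrite lfunE /= vsprojK // fU // subvsP. Qed.

End Restriction.

Record end_aut F b := EndAut {
  end_fun :> 'End(subvs_of (KFbar F b));
  end_equiv : forall g : hom M b b, bijective g ->
    (end_fun \o restr (KFbar F b) (act F g) =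
     restr (KFbar F b) (act F g) \o end_fun)%VF
}.

Definition Phi_fun F b :
    group_algebra K (functor_aut F) -> 'End(subvs_of (KFbar F b)) :=
  ga_ext (fun s => restr (KFbar F b) (aut_act b s)).

Lemma Phi_fun_elt F b (s : functor_aut F) u :
  vsval (Phi_fun b (ga_elt K s) u) = aut_act b s (vsval u).
Proof. by rewrite /Phi_fun ga_ext_elt restrE // => v; apply: KFbar_aut_act. Qed.

Lemma Phi_fun_equiv F b (x : group_algebra K (functor_aut F))
  (g : hom M b b) : bijective g ->
  (Phi_fun b x \o restr (KFbar F b) (act F g) =
   restr (KFbar F b) (act F g) \o Phi_fun b x)%VF.
Proof.
move=> gb; apply/lfunP=> u; rewrite !comp_lfunE /Phi_fun /ga_ext.
rewrite !sum_lfunE linear_sum; apply: eq_bigr => s _.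
rewrite !scale_lfunE linearZ; congr (_ *: _); apply: val_inj => /=.
have sV v := @KFbar_aut_act F b s v.
have gV v := @KFbar_act F b g v gb.
rewrite !restrE //.
by have /lfunP/(_ (vsval u)) := @aut_act_equiv F b s g gb; rewrite !comp_lfunE.
Qed.

Definition Phi F b (x : group_algebra K (functor_aut F)) : end_aut F b :=
  EndAut (Phi_fun_equiv x).

(* Phi is a homomorphism of K-algebras. *)
Lemma Phi_linear F b (a : K) (x y : group_algebra K (functor_aut F)) :
  Phi b (a *: x + y) = a *: (Phi b x : 'End(_)) + Phi b y :> 'End(_).
Proof. exact: (ga_ext_is_linear _ a x y). Qed.

Lemma Phi1 F b : Phi b (1 : group_algebra K (functor_aut F)) = \1%VF :> 'End(_).
Proof.
apply/lfunP=> u; apply: val_inj.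
by rewrite /= (Phi_fun_elt (1%g : functor_aut F)) aut_act1 id_lfunE.
Qed.

Lemma PhiM F b (x y : group_algebra K (functor_aut F)) :
  Phi b (x * y) = (Phi b x \o Phi b y)%VF :> 'End(_).
Proof.
have Psum (r : seq (functor_aut F)) (c : functor_aut F -> K)
    (f : functor_aut F -> group_algebra K (functor_aut F)) u :
    Phi_fun b (\sum_(s <- r) c s *: f s) u = \sum_(s <- r) c s *: Phi_fun b (f s) u.
  have P0 : Phi_fun b 0 = 0 :> 'End(subvs_of (KFbar F b)).
    have := Phi_linear b 1 0 (0 : group_algebra K (functor_aut F)).
    by rewrite /= !scale1r addr0 => /eqP; rewrite -[X in X == _]addr0 (inj_eq (addrI _)) eq_sym => /eqP.
  elim: r => [|s r IH]; first by rewrite !big_nil P0 lfunE.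
  by rewrite !big_cons [Phi_fun _ _](Phi_linear b) add_lfunE scale_lfunE IH.
have PE (z : group_algebra K (functor_aut F)) u :
    Phi_fun b z u = \sum_(s <- ga_supp z) ga_coef z s *: Phi_fun b (ga_elt K s) u.
  by rewrite {1}(ga_sum z) Psum.
have -> : x * y = \sum_(s <- ga_supp x) ga_coef x s *:
    \sum_(t <- ga_supp y) ga_coef y t *: ga_elt K (s * t)%g by [].
apply/lfunP=> u; rewrite comp_lfunE [LHS]Psum [RHS]PE.
apply: eq_bigr => s _; congr (_ *: _); rewrite Psum (PE y u) linear_sum.
apply: eq_bigr => t _; rewrite linearZ; congr (_ *: _); apply: val_inj => /=.
by rewrite !Phi_fun_elt aut_actM.
Qed.

End Representations.

Arguments end_aut {K} charK {A R n M} F b.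
Arguments Phi {K} charK {A R n M} F b x.

(* Main.v *)
From HB Require Import structures.
From mathcomp Require Import all_boot all_algebra.
From mathcomp Require Import finmap boolp.
Require Import Defs.
Set Implicit Arguments. Unset Strict Implicit. Unset Printing Implicit Defensive.
Import GRing.Theory.
Local Open Scope ring_scope.

(** Call [corr D] the linear map attached to a subset [D] of [F b * G b]: it sends
    the basis vector of [x] to the sum of those of all [y] with [(x, y)] in [D].

    Every equivariant map from KF(b) to KG(b) is a linear combination of maps
    [corr D] in which [D] is a submodule of [F b * G b] over the endomorphism ring
    of [b], generated by one element ([equivariant_span]).  Indeed its matrix is
    constant on the orbits of the automorphism group, two elements generating the
    same submodule lie in one orbit because the endomorphism ring is finite
    ([unit_transitive]), and the indicator functions of the sets of generators
    arise from those of the cyclic submodules by Moebius inversion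
    ([downset_span]).

    Let now [G] be [F].  A cyclic [D] is the value at [b] of a linear relation
    between [F] and itself as functors, and by Goursat's lemma such a relation
    identifies a subquotient [Q] of [F] with another one, so that [corr D] factors
    through KQ(b) ([goursat_factor]).  If [Q] is isomorphic to [F], then [D] is the
    graph of an automorphism ([rel_automorphism]).  If not, then [Q] precedes [F],
    and [corr D] followed by an equivariant projection onto the subrepresentation
    [KFbar] vanishes by definition of the latter.  Applied to an endomorphism of
    [KFbar], extended to KF(b) by that projection, this is surjectivity.

    For injectivity, let [a] contain each indecomposable often.  The maps factoring
    through KG(a) with [G] preceding [F] lie in the span of the [corr D] in which
    [D] factors through a set smaller than [F a] ([small_span_factor]); no graph of
    an automorphism is such a [D] ([graph_not_small]).  This span is a left ideal of
    the equivariant endomorphisms ([small_span_ideal]), and by complete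
    reducibility it contains an idempotent [q] with kernel inside [KFbar]
    ([small_idempotent]).  A combination [f] of automorphisms that vanishes on
    [KFbar] equals [f] times [q], hence lies in the span.  As [a] is large, every
    submodule of [F a * F a] is cyclic ([submodule_cyclic]), whence the maps [corr D]
    with [D] a submodule are linearly independent ([corr_free]): evaluation at
    a generator of a maximal [D] isolates its coefficient.  Thus [f] has zero
    coefficients. *)

(** * Generators of cyclic modules over a finite ring *)

Section UnitTransitivity.
Variables (E : finPzRingType) (V : zmodType) (a : E -> V -> V).
Hypothesis a1 : forall x, a 1 x = x.
Hypothesis aM : forall r s x, a (r * s) x = a r (a s x).
Hypothesis aD : forall r s x, a (r + s) x = a r x + a s x.

Let lid (r : E) : {set E} := [set s * r | s : E].

Let lidP r u : reflect (exists s, u = s * r) (u \in lid r).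
Proof. by apply: (iffP imsetP) => -[s]; [exists s | exists s]. Qed.

Let lid_sub r r0 : (lid r \subset lid r0) = (r \in lid r0).
Proof.
apply/subsetP/idP => [h|/lidP[s ->] _ /lidP[u ->]].
  by apply: h; apply/lidP; exists 1; rewrite mul1r.
by apply/lidP; exists (u * s); rewrite mulrA.
Qed.

Let aB r s x : a (r - s) x = a r x - a s x.
Proof. by apply/eqP; rewrite eq_sym subr_eq -aD subrK. Qed.

(** If [x] and [y] generate the same module, then for every left ideal [J] the
    sets of [r] in [J] with [r x = x], resp. [r x = y], are both empty or both
    cosets of the annihilator of [x] in [J].  By Moebius inversion over the left
    ideals, the generators [r] of a left ideal, in particular the units of the
    ring, are equidistributed in the same way, and [1] is one with [r x = x]. *)
Lemma unit_transitive x y s t :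
  a s x = y -> a t y = x -> exists r v, v * r = 1 /\ a r x = y.
Proof.
move=> sx ty.
pose N (J : {set E}) z := #|[set r | (lid r == J) && (a r x == z)]|.
have card_le (r0 : E) z z' w : a w z = z' ->
    (#|[set r in lid r0 | a r x == z]| <= #|[set r in lid r0 | a r x == z']|)%N.
  move=> wz; have [->|[r1]] := set_0Vmem [set r in lid r0 | a r x == z].
    by rewrite cards0.
  rewrite inE => /andP[/lidP[u1 r1E] /eqP r1x].
  rewrite -(card_imset _ (addIr (w * r1 - r1))); apply/subset_leq_card/subsetP.
  move=> _ /imsetP[r rD ->]; move: rD; rewrite inE => /andP[/lidP[u rE] /eqP rx].
  rewrite inE; apply/andP; split.
    by apply/lidP; exists (u + (w * u1 - u1)); rewrite rE r1E !(mulrDl, mulNr, mulrA).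
  by rewrite aD aB aM rx r1x wz addrCA subrr addr0.
have Neq (J : {set E}) : N J x = N J y.
  have [k] := ubnP #|J|; elim: k J => // k IH J /ltnSE Jk.
  case: (pickP (fun r => lid r == J)) => [r0 /eqP r0J|none]; last first.
    by rewrite /N; congr #|pred_of_set _|; apply/setP => r; rewrite !inE none.
  have part z : #|[set r in lid r0 | a r x == z]|
      = (\sum_(J' : {set E} | J' \subset J) N J' z)%N.
    rewrite -sum1_card (partition_big lid (fun J' : {set E} => J' \subset J)) => [|r]; last first.
      by rewrite inE -r0J lid_sub => /andP[].
    apply: eq_bigr => J' sJ'; rewrite /N -sum1_card; apply: eq_bigl => r.
    rewrite !inE andbC; case: eqP => //= rJ'.
    by rewrite -lid_sub r0J rJ' sJ'.
  have: #|[set r in lid r0 | a r x == x]| = #|[set r in lid r0 | a r x == y]|.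
    by apply/eqP; rewrite eqn_leq (card_le _ _ _ s) // (card_le _ _ _ t).
  rewrite !part (bigD1 J) //= [in RHS](bigD1 J) //=.
  rewrite (eq_bigr (N^~ y)) => [/addIn//|J' /andP[sJ' neJ']].
  apply: IH; apply: leq_trans Jk; apply: proper_card.
  by rewrite properEneq neJ'.
have : (0 < N (lid 1%R) y)%N.
  by rewrite -Neq; apply/card_gt0P; exists 1; rewrite inE eqxx a1 eqxx.
case/card_gt0P => r; rewrite inE => /andP[/eqP r1 /eqP rx].
have /lidP[v /esym vr] : 1 \in lid r by rewrite r1; apply/lidP; exists 1; rewrite mul1r.
by exists r, v.
Qed.

End UnitTransitivity.

(** * Indicator functions of principal down-sets *)

Section DownSets.
Variables (X : finType) (down : X -> {set X}) (K : fieldType).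
Hypothesis charK : [pchar K] =i pred0.
Hypothesis down_refl : forall x, x \in down x.
Hypothesis down_trans : forall x y, y \in down x -> down y \subset down x.

Definition indic (D : {set X}) : {ffun X -> K^o} := [ffun x => (x \in D)%:R].

Lemma card_neq0 (D : {set X}) x : x \in D -> #|D|%:R != 0 :> K.
Proof.
by move=> xD; rewrite ((pcharf0P K).1 charK) -lt0n; apply/card_gt0P; exists x.
Qed.

(** The indicator functions of the classes of the equivalence relation
    [down x = down y] arise from those of the sets [down x] by inverting the
    triangular system given by inclusion. *)
Lemma downset_span (P : {ffun X -> K^o} -> Prop) :
    P 0 -> (forall k u v, P u -> P v -> P (k *: u + v)) ->
    (forall x, P (indic (down x))) ->
  forall c : {ffun X -> K^o},
    (forall x y, down x = down y -> c x = c y) -> P c.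
Proof.
move=> P0 Plin Pdown c cE.
pose cls x := [set y | down y == down x].
have cls_refl x : x \in cls x by rewrite inE.
have Psum (Q : pred X) (k : X -> K) (f : X -> {ffun X -> K^o}) :
    (forall x, Q x -> P (f x)) -> P (\sum_(x | Q x) k x *: f x).
  by move=> Pf; apply: big_rec => // x v Qx Pv; apply: Plin (Pf x Qx) Pv.
(* Averaging over a class replaces a choice of representatives. *)
have avg (Q : pred X) (k : X -> K) y :
    (forall x x', down x = down x' -> k x = k x') ->
    (forall x x', down x = down x' -> Q x = Q x') ->
    (\sum_(x | Q x) (k x / #|cls x|%:R) *: indic (cls x)) y = if Q y then k y else 0.
  move=> kE QE; rewrite sum_ffunE.
  transitivity (\sum_(x | Q x && (x \in cls y)) k y / #|cls y|%:R).
    rewrite big_mkcondr; apply: eq_bigr => x _; rewrite !ffunE !inE eq_sym.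
    case: eqP => [e|_]; last by rewrite scaler0.
    rewrite [_ *: _]mulr1 (kE _ _ e); congr (_ / #|pred_of_set _|%:R).
    by apply/setP => z; rewrite !inE e.
  case: ifP => Qy; last first.
    by rewrite big_pred0 // => x; rewrite inE; case: eqP => [/QE->|]; rewrite ?Qy ?andbF.
  rewrite (eq_bigl (mem (cls y))) => [|x]; last first.
    by rewrite inE /= inE; case: eqP => [/QE->|]; rewrite ?Qy ?andbF.
  by rewrite sumr_const -[LHS](@mulr_natr K) (@divfK K) // (card_neq0 (cls_refl y)).
have Pcls x : P (indic (cls x)).
  have [k] := ubnP #|down x|; elim: k x => // k IH x /ltnSE xk.
  pose Q y := (y \in down x) && (down y != down x).
  have QE y y' : down y = down y' -> Q y = Q y'.
    rewrite /Q => e; rewrite e; congr (_ && _); apply/idP/idP => h.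
      by apply: (subsetP (down_trans h)); rewrite e.
    by apply: (subsetP (down_trans h)); rewrite -e.
  have -> : indic (cls x) = -1 *: (\sum_(y | Q y) (1 / #|cls y|%:R) *: indic (cls y))
      + indic (down x).
    apply/ffunP => y; rewrite !ffunE (@avg Q (fun=> 1)) // inE /Q.
    have [yx|yNx] /= := boolP (y \in down x).
      by case: eqP => _ /=; rewrite ?scaler0 ?add0r // [_ *: _]mulr1 addNr.
    rewrite scaler0 add0r; case: eqP => // e.
    by case/negP: yNx; rewrite -e.
  apply: Plin => //; apply: Psum => y /andP[yx neq]; apply: IH.
  by apply: leq_trans xk; apply: proper_card; rewrite properEneq neq down_trans.
have -> : c = \sum_(x | true) (c x / #|cls x|%:R) *: indic (cls x).
  by apply/ffunP => y; rewrite (@avg xpredT c).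
exact: Psum.
Qed.

(** A largest set with nonzero coefficient is the only one of the family to
    contain a given generator of it. *)
Lemma downset_free (C : {pred {set X}}) (k : {set X} -> K) :
    (forall D, D \in C -> exists x, D = down x) ->
    (forall D x, D \in C -> x \in D -> down x \subset D) ->
    (forall D, D \notin C -> k D = 0) ->
    (forall x, \sum_(D : {set X}) k D * (x \in D)%:R = 0) ->
  forall D, k D = 0.
Proof.
move=> Cprinc Cdown kC sum0 D; apply/eqP/negPn/negP => kD.
case: (arg_maxnP (P := fun D => k D != 0) (fun D : {set X} => #|D|) kD) => {kD}.
move=> {}D kD Dmax.
have inC D' : k D' != 0 -> D' \in C.
  by move=> kD'; apply/negPn/negP => /kC e; rewrite e eqxx in kD'.
have [x Dx] := Cprinc D (inC D kD).
have := sum0 x; rewrite (bigD1 D) //= big1 => [|D' neq].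
  by rewrite Dx down_refl mulr1 addr0 -Dx => e; rewrite e eqxx in kD.
have [->|kD'] := eqVneq (k D') 0; first by rewrite mul0r.
have [xD'|] := boolP (x \in D'); last by rewrite mulr0.
case/eqP: neq; apply/esym/eqP; rewrite eqEcard; apply/andP; split; last exact: Dmax.
by rewrite Dx Cdown ?inC.
Qed.

End DownSets.

(** * Correspondences between permutation modules *)

Section Kernels.
Variable K : fieldType.
Implicit Types X Y Z : finType.

Definition kernel_fun X Y (c : {ffun X * Y -> K^o}) (v : {ffun X -> K^o}) :
    {ffun Y -> K^o} :=
  [ffun y => \sum_x v x *: c (x, y)].

Lemma kernel_fun_is_linear X Y c : linear (@kernel_fun X Y c).
Proof.
move=> k u v; apply/ffunP => y; rewrite !ffunE scaler_sumr -big_split /=.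
by apply: eq_bigr => x _; rewrite !ffunE scalerDl scalerA.
Qed.
HB.instance Definition _ X Y (c : {ffun X * Y -> K^o}) :=
  GRing.isLinear.Build K {ffun X -> K^o} {ffun Y -> K^o} _ (kernel_fun c)
    (kernel_fun_is_linear c).

Definition kernel_op X Y (c : {ffun X * Y -> K^o}) :
    'Hom({ffun X -> K^o}, {ffun Y -> K^o}) := linfun (kernel_fun c).

Lemma kernel_opE X Y (c : {ffun X * Y -> K^o}) v y :
  kernel_op c v y = \sum_x v x *: c (x, y).
Proof. by rewrite lfunE ffunE. Qed.

Lemma kernel_op_ubasis X Y (c : {ffun X * Y -> K^o}) x y :
  kernel_op c (ubasis K x) y = c (x, y).
Proof.
rewrite kernel_opE (bigD1 x) //= big1 => [|z /negPf zx]; rewrite ffunE.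
  by rewrite eqxx addr0 scale1r.
by rewrite zx scale0r.
Qed.

Lemma kernel_op_is_linear X Y : linear (@kernel_op X Y).
Proof.
move=> k c d; apply/lfunP => v; rewrite add_lfunE scale_lfunE.
apply/ffunP => y; rewrite !ffunE !kernel_opE scaler_sumr -big_split /=.
by apply: eq_bigr => x _; rewrite !ffunE scalerDr !scalerA mulrC.
Qed.
HB.instance Definition _ X Y :=
  GRing.isLinear.Build K _ 'Hom({ffun X -> K^o}, {ffun Y -> K^o}) _
    (@kernel_op X Y) (@kernel_op_is_linear X Y).

Lemma kernel_op0 X Y : kernel_op (0 : {ffun X * Y -> K^o}) = 0.
Proof. exact: linear0. Qed.
Lemma kernel_opP X Y k (c d : {ffun X * Y -> K^o}) :
  kernel_op (k *: c + d) = k *: kernel_op c + kernel_op d.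
Proof. exact: linearP. Qed.

Definition kernel_of X Y (f : 'Hom({ffun X -> K^o}, {ffun Y -> K^o})) :
    {ffun X * Y -> K^o} := [ffun p => f (ubasis K p.1) p.2].

Lemma kernel_ofK X Y : cancel (@kernel_of X Y) (@kernel_op X Y).
Proof.
move=> f; apply: lfun_ubasis_ext => x; apply/ffunP => y.
by rewrite kernel_op_ubasis ffunE.
Qed.

Definition corr X Y (D : {set X * Y}) := kernel_op (indic K D).

Lemma corr_ubasis X Y (D : {set X * Y}) x y :
  corr D (ubasis K x) y = ((x, y) \in D)%:R.
Proof. by rewrite kernel_op_ubasis ffunE. Qed.

Lemma push_ubasisE X Y (h : X -> Y) x y :
  push K h (ubasis K x) y = (y == h x)%:R.
Proof. by rewrite push_ubasis ffunE. Qed.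

Lemma pushE_inj X Y (h : X -> Y) : injective h ->
  forall v x, push K h v (h x) = v x.
Proof.
move=> hI v x; rewrite pushE sum_ffunE (bigD1 x) //= big1 => [|z /negPf zx].
  by rewrite !ffunE eqxx addr0 [_ *: _]mulr1.
by rewrite !ffunE (inj_eq hI) eq_sym zx scaler0.
Qed.

Definition graph X Y (h : X -> Y) : {set X * Y} := [set p | p.2 == h p.1].

Lemma corr_graph X Y (h : X -> Y) : corr (graph h) = push K h.
Proof.
apply: lfun_ubasis_ext => x; apply/ffunP => y.
by rewrite corr_ubasis inE push_ubasisE.
Qed.

Definition rel_comp X Y Z (D2 : {set Y * Z}) (D1 : {set X * Y}) : {set X * Z} :=
  [set p | [exists y, ((p.1, y) \in D1) && ((y, p.2) \in D2)]].

Lemma corr_comp_ubasis X Y Z (D2 : {set Y * Z}) (D1 : {set X * Y}) x z :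
  (corr D2 \o corr D1)%VF (ubasis K x) z
  = #|[set y | ((x, y) \in D1) && ((y, z) \in D2)]|%:R.
Proof.
rewrite comp_lfunE kernel_opE -sum1_card natr_sum [RHS]big_mkcond /=.
apply: eq_bigr => y _; rewrite corr_ubasis ffunE inE.
by case: (_ \in D1); rewrite ?scale1r ?scale0r //=; case: (_ \in D2).
Qed.

(** The fibres of the composition are empty or translates of one group. *)
Lemma corr_comp (X Y Z : finZmodType) (D2 : {set Y * Z}) (D1 : {set X * Y}) :
    (forall p q, p \in D1 -> q \in D1 -> p - q \in D1) ->
    (forall p q, p \in D2 -> q \in D2 -> p - q \in D2) ->
    (forall p q, p \in D1 -> q \in D1 -> p + q \in D1) ->
    (forall p q, p \in D2 -> q \in D2 -> p + q \in D2) ->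
  exists k : K, (corr D2 \o corr D1)%VF = k *: corr (rel_comp D2 D1).
Proof.
move=> D1B D2B D1D D2D.
exists #|[set y | ((0, y) \in D1) && ((y, 0) \in D2)]|%:R.
apply: lfun_ubasis_ext => x; apply/ffunP => z.
rewrite corr_comp_ubasis scale_lfunE ffunE corr_ubasis inE /=.
case: existsP => [[y0 /andP[xy0 yz0]]|none]; last first.
  rewrite scaler0 (_ : [set y | _] = set0) ?cards0 //.
  by apply/setP => y; rewrite !inE; apply/negP => h; apply: none; exists y.
rewrite [RHS]mulr1 -[in RHS](card_imset _ (addIr y0)); congr #|pred_of_set _|%:R.
apply/setP => y; rewrite inE; apply/andP/imsetP => [[xy yz]|[w]].
  exists (y - y0); rewrite ?subrK // inE.
  by rewrite -{1}(subrr x) (D1B (x, y) (x, y0)) // -(subrr z) (D2B (y, z) (y0, z)).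
rewrite inE => /andP[w1 w2] ->; split.
  by rewrite -[x]add0r; apply: (D1D (0, w) (x, y0)).
by rewrite -[z]add0r; apply: (D2D (w, 0) (y0, z)).
Qed.

End Kernels.

(** * The finite ring of endomorphisms of a finite module *)

Section EndomorphismRing.
Variables (R : nzRingType) (X : finLmodType R).

Record endo := Endo { endo_fun : {ffun X -> X}; _ : `[< linear endo_fun >] }.
HB.instance Definition _ := [isSub for endo_fun].
HB.instance Definition _ := [Finite of endo by <:].

Definition endo_app (e : endo) (x : X) : X := endo_fun e x.

Lemma endo_app_linear e : linear (endo_app e).
Proof. exact: (asboolW (valP e)). Qed.
HB.instance Definition _ e :=
  GRing.isLinear.Build R X X _ (endo_app e) (endo_app_linear e).

Definition endo_lin (e : endo) : {linear X -> X} := endo_app e.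

Lemma endo_of_subproof (f : {linear X -> X}) : `[< linear [ffun x => f x] >].
Proof. by apply/asboolP => k x y; rewrite !ffunE linearP. Qed.
Definition endo_of (f : {linear X -> X}) : endo := Endo (endo_of_subproof f).

Lemma endo_ofE f x : endo_app (endo_of f) x = f x.
Proof. exact: ffunE. Qed.

Lemma endo_ext e e' : endo_app e =1 endo_app e' -> e = e'.
Proof. by move=> h; apply: val_inj; apply/ffunP. Qed.

Lemma endo_ofK f : endo_lin (endo_of f) = f.
Proof. by apply: linear_ext => x; rewrite /= endo_ofE. Qed.

Definition endo_zero : endo := endo_of \0.
Definition endo_one : endo := endo_of idfun.
Definition endo_opp e : endo := endo_of (\- endo_lin e).
Definition endo_add e e' : endo := endo_of (endo_lin e \+ endo_lin e').
Definition endo_mul e e' : endo := endo_of (endo_lin e \o endo_lin e').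

Lemma endo_addA : associative endo_add.
Proof. by move=> e f g; apply: endo_ext => x; rewrite !endo_ofE /= !endo_ofE addrA. Qed.
Lemma endo_addC : commutative endo_add.
Proof. by move=> e f; apply: endo_ext => x; rewrite !endo_ofE /= addrC. Qed.
Lemma endo_add0 : left_id endo_zero endo_add.
Proof. by move=> e; apply: endo_ext => x; rewrite !endo_ofE /= endo_ofE add0r. Qed.
Lemma endo_addN : left_inverse endo_zero endo_opp endo_add.
Proof. by move=> e; apply: endo_ext => x; rewrite !endo_ofE /= endo_ofE addNr. Qed.
Lemma endo_mulA : associative endo_mul.
Proof. by move=> e f g; apply: endo_ext => x; rewrite !endo_ofE /= !endo_ofE. Qed.
Lemma endo_mul1 : left_id endo_one endo_mul.
Proof. by move=> e; apply: endo_ext => x; rewrite !endo_ofE /= !endo_ofE. Qed.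
Lemma endo_mulr1 : right_id endo_one endo_mul.
Proof. by move=> e; apply: endo_ext => x; rewrite !endo_ofE /= !endo_ofE. Qed.
Lemma endo_mulDl : left_distributive endo_mul endo_add.
Proof. by move=> e f g; apply: endo_ext => x; rewrite !endo_ofE /= !endo_ofE. Qed.
Lemma endo_mulDr : right_distributive endo_mul endo_add.
Proof.
by move=> e f g; apply: endo_ext => x; rewrite !endo_ofE /= !endo_ofE linearD.
Qed.
HB.instance Definition _ := GRing.isPzRing.Build endo
  endo_addA endo_addC endo_add0 endo_addN
  endo_mulA endo_mul1 endo_mulr1 endo_mulDl endo_mulDr.

Lemma endo_linM (e f : endo) : endo_lin (e * f) = endo_lin e \o endo_lin f.
Proof. exact: endo_ofK. Qed.
Lemma endo_linD (e f : endo) x :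
  endo_lin (e + f) x = endo_lin e x + endo_lin f x.
Proof. exact: endo_ofE. Qed.
Lemma endo_lin1 : endo_lin 1 = idfun.
Proof. exact: endo_ofK. Qed.

(** A one-sided inverse in [endo] is two-sided, the module being finite. *)
Lemma endo_mulV_bij (u v : endo) :
  v * u = 1 -> bijective (endo_lin u) /\ bijective (endo_lin v).
Proof.
move=> vu; have uK : cancel (endo_lin u) (endo_lin v).
  by move=> x; have := congr1 (fun e => endo_lin e x) vu; rewrite endo_linM endo_lin1.
have ub := injF_bij (can_inj uK); split=> //.
by exists (endo_lin u) => //; apply/(bij_can_sym ub).
Qed.

End EndomorphismRing.

Lemma linear_inverse (R : nzRingType) (U V : lmodType R) (f : {linear U -> V}) :
  bijective f -> exists g : {linear V -> U}, cancel f g /\ cancel g f.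
Proof.
case=> g fK gK; have gl : linear g by apply: can2_linear fK gK.
pose gL := GRing.isLinear.Build R V U *:%R g gl.
pose g' : {linear V -> U} := HB.pack g gL.
by exists g'.
Qed.

(** * Functors on objects, sums of functors and cyclic submodules *)

Section Functors.
Variables (A : comNzRingType) (R : finAlgType A).
Variables (n : nat) (M : 'I_n -> finLmodType R).
Implicit Types (F G : lin_functor M) (b c : obj n).

Lemma fmapD F b c (f g h : hom M b c) :
  (forall x, h x = f x + g x) -> forall y, fmap F h y = fmap F f y + fmap F g y.
Proof.
move=> e y; rewrite (@fmap_linear _ _ _ _ F _ _ 1 f g h) ?scale1r // => x.
by rewrite e !scale1r.
Qed.

Lemma fmap0 F b c (f : hom M b c) : (forall x, f x = 0) -> forall y, fmap F f y = 0.
Proof.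
move=> e y; apply: (addrI (fmap F f y)); rewrite addr0.
by apply/esym/fmapD => x; rewrite e addr0.
Qed.

Lemma fmap_sum F b c (I : finType) (f : I -> hom M b c) (h : hom M b c) :
  (forall x, h x = \sum_i f i x) -> forall y, fmap F h y = \sum_i fmap F (f i) y.
Proof.
move: (index_enum I) => s.
have ex t : exists g : hom M b c, forall x, g x = \sum_(i <- t) f i x.
  elim: t => [|i t [g gE]]; first by exists \0 => x; rewrite big_nil.
  by exists (f i \+ g) => x; rewrite big_cons -gE.
elim: s h => [|i s IH] h e y.
  by rewrite big_nil; apply: fmap0 => x; rewrite e big_nil.
have [g gE] := ex s.
by rewrite big_cons -(IH g) //; apply: fmapD => x; rewrite e big_cons gE.
Qed.

End Functors.

Definition pair_module (R : nzRingType) (U V : finLmodType R) : finLmodType R :=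
  HB.pack_for (finLmodType R) (U * V)%type.

Section FunctorSum.
Variables (A : comNzRingType) (R : finAlgType A).
Variables (n : nat) (M : 'I_n -> finLmodType R).
Variables F G : lin_functor M.
Implicit Types b c d : obj n.

Definition pair_map b c (f : hom M b c) (u : F b * G b) : F c * G c :=
  (fmap F f u.1, fmap G f u.2).

Lemma pair_map_linear b c (f : hom M b c) : linear (pair_map f).
Proof. by move=> k u v; rewrite /pair_map /= !linearP. Qed.
HB.instance Definition _ b c (f : hom M b c) :=
  GRing.isLinear.Build A (F b * G b)%type (F c * G c)%type _
    (pair_map f) (pair_map_linear f).

Lemma pair_map_id b u : pair_map (idfun : hom M b b) u = u.
Proof. by case: u => u v; rewrite /pair_map !fmap_id. Qed.
Lemma pair_map_comp b c d (g : hom M c d) (f : hom M b c) u :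
  pair_map (g \o f : hom M b d) u = pair_map g (pair_map f u).
Proof. by rewrite /pair_map !fmap_comp. Qed.
Lemma pair_map_linearl b c (k : A) (f g h : hom M b c) :
    (forall x, h x = k%:A *: f x + g x) ->
  forall u, pair_map h u = k *: pair_map f u + pair_map g u.
Proof. by move=> e u; rewrite /pair_map !(fmap_linear e). Qed.

Definition functor_sum : lin_functor M :=
  @LinFunctor A R n M (fun b => pair_module (F b) (G b))
    (fun b c (f : hom M b c) => pair_map f) pair_map_id pair_map_comp
    pair_map_linearl.

End FunctorSum.

Section Submodules.
Variables (A : comNzRingType) (R : finAlgType A).
Variables (n : nat) (M : 'I_n -> finLmodType R).
Implicit Types (F G : lin_functor M) (b c : obj n).

Lemma fmap_bij F b c (g : hom M b c) : bijective g -> bijective (fmap F g).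
Proof.
move=> /linear_inverse[h [gK hK]]; exists (fmap F h) => x.
  rewrite -fmap_comp (_ : (h \o g : hom M b b) = idfun) ?fmap_id //.
  by apply: linear_ext => z; apply: gK.
rewrite -fmap_comp (_ : (g \o h : hom M c c) = idfun) ?fmap_id //.
by apply: linear_ext => z; apply: hK.
Qed.

Definition endo_stable F b (D : {set F b}) : Prop :=
  forall (f : hom M b b) x, x \in D -> fmap F f x \in D.

Definition submodule F b (D : {set F b}) : Prop :=
  [/\ 0 \in D, forall x y, x \in D -> y \in D -> x - y \in D & endo_stable D].

Lemma submoduleD F b (D : {set F b}) x y :
  submodule D -> x \in D -> y \in D -> x + y \in D.
Proof.
by case=> D0 DB _ xD yD; rewrite -[y]opprK DB // -sub0r DB.
Qed.

(** Finiteness replaces the inverse of [g]: an injective map of the finite set [D]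
    into itself is onto. *)
Lemma endo_stable_iff F b (D : {set F b}) (g : hom M b b) x :
  endo_stable D -> bijective g -> (fmap F g x \in D) = (x \in D).
Proof.
move=> Df gb; apply/idP/idP; last exact: Df.
have gI := bij_inj (fmap_bij F gb).
have /eqP gD : fmap F g @: D == D.
  rewrite eqEcard card_imset // leqnn andbT; apply/subsetP => _ /imsetP[y yD ->].
  exact: Df.
by rewrite -{1}gD mem_imset.
Qed.

(** Indexed by [endo] rather than [hom M b b] because [endo] is a finite type. *)
Definition cyclic_sub F b (x : F b) : {set F b} :=
  [set fmap F (endo_lin r) x | r : endo (obj_mod M b)].

Lemma cyclic_subP F b (x y : F b) :
  reflect (exists f : hom M b b, y = fmap F f x) (y \in cyclic_sub x).
Proof.
apply: (iffP imsetP) => [[r _ ->]|[f ->]]; first by exists (endo_lin r).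
by exists (endo_of f); rewrite ?endo_ofK.
Qed.

Lemma cyclic_sub_refl F b (x : F b) : x \in cyclic_sub x.
Proof. by apply/cyclic_subP; exists idfun; rewrite fmap_id. Qed.

Lemma cyclic_sub_submodule F b (x : F b) : submodule (cyclic_sub x).
Proof.
split.
- by apply/cyclic_subP; exists \0; rewrite fmap0.
- move=> _ _ /cyclic_subP[f ->] /cyclic_subP[g ->]; apply/cyclic_subP.
  exists (f \- g); apply/eqP; rewrite subr_eq; apply/eqP.
  by apply: fmapD => y /=; rewrite subrK.
- move=> f _ /cyclic_subP[g ->]; apply/cyclic_subP.
  by exists (f \o g); rewrite fmap_comp.
Qed.

Lemma cyclic_sub_min F b (x : F b) (D : {set F b}) :
  submodule D -> x \in D -> cyclic_sub x \subset D.
Proof. by case=> _ _ Df xD; apply/subsetP => _ /cyclic_subP[f ->]; apply: Df. Qed.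

Lemma cyclic_sub_trans F b (x y : F b) :
  y \in cyclic_sub x -> cyclic_sub y \subset cyclic_sub x.
Proof. by apply: cyclic_sub_min; apply: cyclic_sub_submodule. Qed.

(** Over a finite ring, generators of one cyclic module differ by a unit. *)
Lemma cyclic_sub_unit F b (x y : F b) : cyclic_sub x = cyclic_sub y ->
  exists2 g : hom M b b, bijective g & fmap F g x = y.
Proof.
move=> e.
have /imsetP[s _ yE] : y \in cyclic_sub x by rewrite e cyclic_sub_refl.
have /imsetP[t _ xE] : x \in cyclic_sub y by rewrite -e cyclic_sub_refl.
pose E := endo (obj_mod M b).
have a1 (z : F b) : fmap F (endo_lin (1 : E)) z = z by rewrite endo_lin1 fmap_id.
have aM (r r' : E) z : fmap F (endo_lin (r * r')) z = fmap F (endo_lin r) (fmap F (endo_lin r') z).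
  by rewrite endo_linM fmap_comp.
have aD (r r' : E) z : fmap F (endo_lin (r + r')) z = fmap F (endo_lin r) z + fmap F (endo_lin r') z.
  by apply: fmapD => w; apply: endo_linD.
have [r [v [vr rx]]] := unit_transitive (a := fun (r : E) z => fmap F (endo_lin r) z)
  a1 aM aD (esym yE) (esym xE).
by exists (endo_lin r) => //; have [] := endo_mulV_bij vr.
Qed.

End Submodules.

(** * Equivariant maps between permutation modules *)

Section Equivariance.
Variables (K : fieldType) (charK : [pchar K] =i pred0).
Variables (A : comNzRingType) (R : finAlgType A).
Variables (n : nat) (M : 'I_n -> finLmodType R).
Variable b : obj n.
Implicit Types (F G H : lin_functor M).

Local Notation KF F := (KF K F b).

(** The matrix of an equivariant map is constant on orbits. *)
Lemma equivariantP F G (f : 'Hom(KF F, KF G)) :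
  equivariant f <-> forall g : hom M b b, bijective g ->
    forall x y, f (ubasis K (fmap F g x)) (fmap G g y) = f (ubasis K x) y.
Proof.
split=> [fe g gb x y|fe g gb].
  have /lfunP/(_ (ubasis K x)) := fe g gb; rewrite !comp_lfunE /act push_ubasis => ->.
  by rewrite pushE_inj //; apply/bij_inj/fmap_bij.
apply: lfun_ubasis_ext => x; apply/ffunP => y.
rewrite !comp_lfunE /act push_ubasis; have [h _ hK] := fmap_bij G gb.
by rewrite -[y]hK fe // pushE_inj //; apply/bij_inj/fmap_bij.
Qed.

Lemma equivariant_comp F G H (f : 'Hom(KF F, KF G)) (h : 'Hom(KF G, KF H)) :
  equivariant f -> equivariant h -> equivariant (h \o f)%VF.
Proof. by move=> fe he g gb; rewrite -comp_lfunA fe // !comp_lfunA he. Qed.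

Lemma equivariantZD F G k (f h : 'Hom(KF F, KF G)) :
  equivariant f -> equivariant h -> equivariant (k *: f + h).
Proof.
move=> fe he g gb.
by rewrite comp_lfunDl comp_lfunDr -comp_lfunZl -comp_lfunZr fe // he.
Qed.

Lemma equivariant1 F : equivariant (\1%VF : 'Hom(KF F, KF F)).
Proof. by move=> g _; rewrite comp_lfun1l comp_lfun1r. Qed.

Lemma endo_stable_pair F G (D : {set functor_sum F G b}) (g : hom M b b) x y :
    endo_stable D -> bijective g ->
  ((fmap F g x, fmap G g y) \in (D : {set F b * G b}))
  = ((x, y) \in (D : {set F b * G b})).
Proof.
move=> Df gb; transitivity (fmap (functor_sum F G) g (x, y) \in D); first by [].
by rewrite endo_stable_iff.
Qed.

Lemma corr_equivariant F G (D : {set F b * G b}) :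
    (forall (f : hom M b b) x y, (x, y) \in D -> (fmap F f x, fmap G f y) \in D) ->
  equivariant (corr K D : 'Hom(KF F, KF G)).
Proof.
move=> Df; have Ds : endo_stable (D : {set functor_sum F G b}).
  by move=> f [x y]; apply: Df.
apply/equivariantP => g gb x y.
by rewrite !corr_ubasis (endo_stable_pair _ _ Ds gb).
Qed.

(** The orbits of the automorphisms on [F b * G b] are the sets of generators of
    the cyclic submodules, since [cyclic_sub_unit] applies to [functor_sum F G];
    hence the matrix of [f] is a combination of indicators of cyclic submodules. *)
Lemma equivariant_span F G (P : 'Hom(KF F, KF G) -> Prop) :
    P 0 -> (forall k u v, P u -> P v -> P (k *: u + v)) ->
    (forall x : functor_sum F G b, P (corr K (cyclic_sub x))) ->
  forall f, equivariant f -> P f.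
Proof.
move=> P0 Plin Pcyc f /equivariantP fe; rewrite -[f]kernel_ofK.
pose down (x : F b * G b) : {set F b * G b} := cyclic_sub (x : functor_sum F G b).
have down_refl x : x \in down x.
  exact (@cyclic_sub_refl _ _ _ _ (functor_sum F G) b x).
have down_trans x y : y \in down x -> down y \subset down x.
  exact (@cyclic_sub_trans _ _ _ _ (functor_sum F G) b x y).
apply: (downset_span charK down_refl down_trans (P := fun c => P (kernel_op c))).
- by rewrite kernel_op0.
- by move=> k u v Pu Pv; rewrite kernel_opP; apply: Plin.
- exact: Pcyc.
- move=> x y e; rewrite !ffunE.
  have [g gb gx] := @cyclic_sub_unit _ _ _ _ (functor_sum F G) b x y e.
  have -> : y.1 = fmap F g x.1 by rewrite -gx.
  have -> : y.2 = fmap G g x.2 by rewrite -gx.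
  by rewrite fe.
Qed.

Local Notation E := (endo (obj_mod M b)).

(** The pairs [(r, r^-1)] with [r] a unit index the automorphism group of [b];
    in a finite ring one of the two equations for an inverse suffices. *)
Definition average F G (f : 'Hom(KF F, KF G)) : 'Hom(KF F, KF G) :=
  (#|[set p : E * E | p.1 * p.2 == 1]|%:R)^-1 *:
    \sum_(p : E * E | p.1 * p.2 == 1)
       (act K G (endo_lin p.1) \o f \o act K F (endo_lin p.2))%VF.

Lemma averageE F G (f : 'Hom(KF F, KF G)) v : average f v =
  (#|[set p : E * E | p.1 * p.2 == 1]|%:R)^-1 *:
    \sum_(p : E * E | p.1 * p.2 == 1)
       act K G (endo_lin p.1) (f (act K F (endo_lin p.2) v)).
Proof.
rewrite /average scale_lfunE sum_lfunE; congr (_ *: _).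
by apply: eq_bigr => p _; rewrite !comp_lfunE.
Qed.

Lemma actM F (r s : E) v :
  act K F (endo_lin (r * s)) v = act K F (endo_lin r) (act K F (endo_lin s) v).
Proof.
by rewrite /act push_comp; apply: eq_push => x; rewrite endo_linM fmap_comp.
Qed.

Lemma act1 F v : act K F (endo_lin (1 : E)) v = v.
Proof. by apply: push_id => x; rewrite endo_lin1 fmap_id. Qed.

Lemma average_equivariant F G (f : 'Hom(KF F, KF G)) : equivariant (average f).
Proof.
move=> g gb; have [h [gK hK]] := linear_inverse gb.
pose r := endo_of g; pose s := endo_of h.
have rs : r * s = 1 by apply: endo_ext => x; rewrite !endo_ofE /= !endo_ofE.
have sr : s * r = 1 by apply: endo_ext => x; rewrite !endo_ofE /= !endo_ofE.
apply/lfunP => v; rewrite !comp_lfunE !averageE linearZ; congr (_ *: _).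
rewrite linear_sum /=; rewrite -[g]endo_ofK -/r.
have hb : bijective (fun p : E * E => (r * p.1, p.2 * s)).
  exists (fun p => (s * p.1, p.2 * r)) => -[p q] /=;
  by rewrite -!mulrA ?(mulrA s r) ?(mulrA r s) ?rs ?sr ?mul1r ?mulr1.
rewrite (reindex _ (onW_bij _ hb)) /=.
rewrite (eq_bigl (fun p : E * E => p.1 * p.2 == 1)) => [|[p q]] /=.
  by apply: eq_bigr => -[p q] _ /=; rewrite -(actM (q * s)) -mulrA sr mulr1 actM.
apply/eqP/eqP => [/(congr1 (fun z => s * z * r))|e].
  by rewrite /= !mulrA sr mul1r -(mulrA _ s r) sr !mulr1 sr => ->.
by rewrite -mulrA (mulrA p) e mul1r rs.
Qed.

(** This is where the order of the automorphism group has to be invertible in [K]. *)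
Lemma average_fix F G H (f : 'Hom(KF F, KF G)) (h : 'Hom(KF G, KF H)) v w :
    (forall p q : E, p * q = 1 ->
       h (act K G (endo_lin p) (f (act K F (endo_lin q) v))) = w) ->
  h (average f v) = w.
Proof.
move=> e; rewrite averageE linearZ linear_sum /=.
rewrite (eq_bigr (fun=> w)) => [|[p q] /eqP /e //].
rewrite sumr_const -scaler_nat scalerA cardsE mulVf ?scale1r // -cardsE.
have e1 : (1 : E) * 1 == 1 by rewrite mulr1.
by apply: (card_neq0 charK (x := (1 : E, 1 : E))); rewrite inE.
Qed.

(** The average of a linear pseudo-inverse is an equivariant one. *)
Lemma equivariant_regular F G (f : 'Hom(KF F, KF G)) : equivariant f ->
  exists2 g : 'Hom(KF G, KF F), equivariant g & (f \o g \o f)%VF = f.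
Proof.
move=> fe; exists (average f^-1%VF); first exact: average_equivariant.
apply/lfunP => v; rewrite !comp_lfunE; apply: average_fix => p q pq.
have [qb pb] := endo_mulV_bij pq.
have fact r w : bijective (endo_lin r) ->
    f (act K F (endo_lin r) w) = act K G (endo_lin r) (f w).
  by move=> rb; have /lfunP/(_ w) := fe _ rb; rewrite !comp_lfunE.
rewrite fact // -(fact q) // limg_lfunVK ?memv_img ?memvf //.
by rewrite fact // -actM pq act1.
Qed.

Lemma equivariant_projection F (V : {vspace KF F}) : subrep V ->
  exists p : 'End(KF F),
    [/\ equivariant p, forall v, p v \in V & forall v, v \in V -> p v = v].
Proof.
move=> Vi; exists (average (projv V)).
have actV r v : bijective (endo_lin r) -> v \in V -> act K F (endo_lin r) v \in V.
  by move=> rb vV; apply: (subvP (Vi _ rb)); apply: memv_img.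
split=> [|v|v vV]; first exact: average_equivariant.
- rewrite averageE memvZ // memv_suml // => -[p q] /= /eqP pq.
  have [_ pb] := endo_mulV_bij pq.
  by apply: actV => //; apply: memv_proj.
- rewrite -[LHS]id_lfunE; apply: (average_fix (h := \1%VF)) => p q pq.
  have [qb pb] := endo_mulV_bij pq.
  by rewrite id_lfunE projv_id ?actV // -actM pq act1.
Qed.

End Equivariance.

(** * Subquotients of functors *)

Section SubquotientModule.
Variables (A : nzRingType) (U : finLmodType A).

Definition lin_closed (S : {set U}) : Prop :=
  0 \in S /\ forall (k : A) x y, x \in S -> y \in S -> k *: x + y \in S.

Lemma lin_closedD S x y : lin_closed S -> x \in S -> y \in S -> x + y \in S.
Proof. by case=> _ SP xS yS; rewrite -[x]scale1r SP. Qed.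

Lemma lin_closedZ S k x : lin_closed S -> x \in S -> k *: x \in S.
Proof. by case=> S0 SP xS; rewrite -[_ *: _]addr0 SP. Qed.

Lemma lin_closedB S x y : lin_closed S -> x \in S -> y \in S -> x - y \in S.
Proof. by case=> S0 SP xS yS; rewrite -scaleN1r addrC SP. Qed.

Lemma lin_closedN S x : lin_closed S -> (- x \in S) = (x \in S).
Proof.
move=> SP; apply/idP/idP => h; last by rewrite -sub0r lin_closedB //; case: SP.
by rewrite -[x]opprK -sub0r lin_closedB //; case: SP.
Qed.

Record layer := Layer {
  top : {set U};
  bot : {set U};
  top_closed : lin_closed top;
  bot_closed : lin_closed bot;
  bot_sub_top : {subset bot <= top}
}.

Variable s : layer.

(** One representative of each coset stands for it, so that the quotient of [top s]
    by [bot s] is a subtype of the finite type [U]. *)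
Definition rep (u : U) : U := odflt u [pick v | v - u \in bot s].

Lemma rep_sub u : rep u - u \in bot s.
Proof.
by rewrite /rep; case: pickP => //= _; rewrite subrr; case: (bot_closed s).
Qed.

Lemma rep_eq u w : u - w \in bot s -> rep u = rep w.
Proof.
move=> uw; have e : (fun v => v - u \in bot s) =1 (fun v => v - w \in bot s).
  move=> v; apply/idP/idP => h.
    by rewrite -(subrKA u) lin_closedD //; apply: bot_closed.
  rewrite -(subrKA w) lin_closedD //; first exact: bot_closed.
  by rewrite -opprB lin_closedN //; apply: bot_closed.
rewrite /rep (eq_pick e); case: pickP => //= /(_ w).
by rewrite subrr; case: (bot_closed s) => ->.
Qed.

Lemma rep_top u : u \in top s -> rep u \in top s.
Proof.
move=> ut; rewrite -[rep u](subrK u) lin_closedD //; first exact: top_closed.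
exact/bot_sub_top/rep_sub.
Qed.

Record layer_mod :=
  LayerMod { layer_val : U; _ : (layer_val \in top s) && (rep layer_val == layer_val) }.
HB.instance Definition _ := [isSub for layer_val].
HB.instance Definition _ := [Finite of layer_mod by <:].

Lemma layer_val_top (q : layer_mod) : layer_val q \in top s.
Proof. by case/andP: (valP q). Qed.

Lemma layer_zero_subproof : (rep 0 \in top s) && (rep (rep 0) == rep 0).
Proof.
by rewrite rep_top ?(rep_eq (rep_sub 0)) ?eqxx //; case: (top_closed s).
Qed.
Definition layer_zero := LayerMod layer_zero_subproof.

Definition cls (u : U) : layer_mod := insubd layer_zero (rep u).

Lemma layer_val_cls u : u \in top s -> layer_val (cls u) = rep u.
Proof.
move=> ut; rewrite -[LHS]/(val (cls u)) val_insubd rep_top //=.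
by rewrite (rep_eq (rep_sub u)) eqxx.
Qed.

Lemma layer_valK q : cls (layer_val q) = q.
Proof.
apply: val_inj => /=; rewrite layer_val_cls ?layer_val_top //.
by case/andP: (valP q) => _ /eqP.
Qed.

Lemma cls_eq u w : u - w \in bot s -> cls u = cls w.
Proof. by move=> /rep_eq e; rewrite /cls e. Qed.

Lemma cls_val_sub u : u \in top s -> layer_val (cls u) - u \in bot s.
Proof. by move=> ut; rewrite layer_val_cls // rep_sub. Qed.

Definition layer_lin (k : A) (p q : layer_mod) :=
  cls (k *: layer_val p + layer_val q).

Lemma layer_linE k u w : u \in top s -> w \in top s ->
  layer_lin k (cls u) (cls w) = cls (k *: u + w).
Proof.
move=> ut wt; apply: cls_eq; rewrite opprD addrACA -scalerBr.
by have [_ bP] := bot_closed s; apply: bP; apply: cls_val_sub.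
Qed.

Definition layer_add p q := layer_lin 1 p q.
Definition layer_scale k p := layer_lin k p layer_zero.
Definition layer_opp p := layer_scale (-1) p.

Lemma cls0 : cls 0 = layer_zero.
Proof. by apply: val_inj; rewrite /= layer_val_cls //; case: (top_closed s). Qed.

Lemma cls_ind (P : layer_mod -> Prop) : (forall u, u \in top s -> P (cls u)) -> forall q, P q.
Proof. by move=> h q; rewrite -[q]layer_valK; apply/h/layer_val_top. Qed.

Lemma clsD u w : u \in top s -> w \in top s ->
  layer_add (cls u) (cls w) = cls (u + w).
Proof. by move=> ut wt; rewrite /layer_add layer_linE // scale1r. Qed.

Lemma clsZ k u : u \in top s -> layer_scale k (cls u) = cls (k *: u).
Proof.
by move=> ut; rewrite /layer_scale -cls0 layer_linE ?addr0 //; case: (top_closed s).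
Qed.

Let tD u w : u \in top s -> w \in top s -> u + w \in top s.
Proof. by apply: lin_closedD; apply: top_closed. Qed.
Let tZ k u : u \in top s -> k *: u \in top s.
Proof. by apply: lin_closedZ; apply: top_closed. Qed.

Lemma layer_addA : associative layer_add.
Proof.
elim/cls_ind => u ut; elim/cls_ind => v vt; elim/cls_ind => w wt.
by rewrite !clsD ?tD // addrA.
Qed.
Lemma layer_addC : commutative layer_add.
Proof.
by elim/cls_ind => u ut; elim/cls_ind => v vt; rewrite !clsD // addrC.
Qed.
Lemma layer_add0 : left_id layer_zero layer_add.
Proof.
by elim/cls_ind => u ut; rewrite -cls0 clsD ?add0r //; case: (top_closed s).
Qed.
Lemma layer_addN : left_inverse layer_zero layer_opp layer_add.
Proof.
by elim/cls_ind => u ut; rewrite /layer_opp clsZ // clsD ?tZ // scaleN1r addNr cls0.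
Qed.
HB.instance Definition _ :=
  GRing.isZmodule.Build layer_mod layer_addA layer_addC layer_add0 layer_addN.

Lemma cls_add u w : u \in top s -> w \in top s -> cls u + cls w = cls (u + w).
Proof. exact: clsD. Qed.

Lemma layer_scaleA a b p : layer_scale a (layer_scale b p) = layer_scale (a * b) p.
Proof. by elim/cls_ind: p => u ut; rewrite !clsZ ?tZ // scalerA. Qed.
Lemma layer_scale1 : left_id 1 layer_scale.
Proof. by elim/cls_ind => u ut; rewrite clsZ // scale1r. Qed.
Lemma layer_scaleDr : right_distributive layer_scale +%R.
Proof.
move=> a; elim/cls_ind => u ut; elim/cls_ind => v vt.
by rewrite cls_add // !clsZ ?tD // cls_add ?tZ // scalerDr.
Qed.
Lemma layer_scaleDl p : {morph layer_scale^~ p : a b / a + b}.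
Proof.
by move=> a b; elim/cls_ind: p => u ut; rewrite !clsZ // cls_add ?tZ // scalerDl.
Qed.
HB.instance Definition _ := GRing.Zmodule_isLmodule.Build A layer_mod
  layer_scaleA layer_scale1 layer_scaleDr layer_scaleDl.

Lemma cls_lin (k : A) u w : u \in top s -> w \in top s ->
  cls (k *: u + w) = k *: cls u + cls w :> layer_mod.
Proof. by move=> ut wt; rewrite -[k *: cls u]/(layer_scale k _) clsZ // cls_add ?tZ. Qed.

End SubquotientModule.

Arguments layer_mod {A U} s.
Arguments cls {A U} s u.

Section SubquotientFunctor.
Variables (A : comNzRingType) (R : finAlgType A).
Variables (n : nat) (M : 'I_n -> finLmodType R).
Variable F : lin_functor M.

Record layers := Layers {
  layer_at :> forall b, layer (F b);
  layer_top_map : forall b c (f : hom M b c) x,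
    x \in top (layer_at b) -> fmap F f x \in top (layer_at c);
  layer_bot_map : forall b c (f : hom M b c) x,
    x \in bot (layer_at b) -> fmap F f x \in bot (layer_at c)
}.

Section Functor.
Variable s : layers.

Definition layer_map b c (f : hom M b c) (q : layer_mod (s b)) : layer_mod (s c) :=
  cls (s c) (fmap F f (layer_val q)).

Lemma layer_map_cls b c (f : hom M b c) u :
  u \in top (s b) -> layer_map f (cls (s b) u) = cls (s c) (fmap F f u).
Proof.
move=> ut; apply: cls_eq; rewrite -linearB.
exact/layer_bot_map/cls_val_sub.
Qed.

Lemma layer_map_linear b c (f : hom M b c) : linear (layer_map f).
Proof.
move=> k; elim/cls_ind => u ut; elim/cls_ind => w wt.
rewrite -cls_lin // !layer_map_cls //; last first.
  by have [_ tP] := top_closed (s b); apply: tP.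
by rewrite linearP cls_lin //; apply: layer_top_map.
Qed.
HB.instance Definition _ b c (f : hom M b c) :=
  GRing.isLinear.Build A (layer_mod (s b)) (layer_mod (s c)) _
    (layer_map f) (layer_map_linear f).

Lemma layer_map_id b q : layer_map (idfun : hom M b b) q = q.
Proof. by rewrite /layer_map fmap_id layer_valK. Qed.
Lemma layer_map_comp b c d (g : hom M c d) (f : hom M b c) q :
  layer_map (g \o f : hom M b d) q = layer_map g (layer_map f q).
Proof.
elim/cls_ind: q => u ut; rewrite !layer_map_cls // ?fmap_comp //.
exact: layer_top_map.
Qed.
Lemma layer_map_linearl b c (k : A) (f g h : hom M b c) :
    (forall x, h x = k%:A *: f x + g x) ->
  forall q, layer_map h q = k *: layer_map f q + layer_map g q.
Proof.
move=> e; elim/cls_ind => u ut; rewrite !layer_map_cls // (fmap_linear e).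
by rewrite cls_lin //; apply: layer_top_map.
Qed.

Definition layer_functor : lin_functor M :=
  @LinFunctor A R n M
    (fun b => HB.pack_for (finLmodType A) (layer_mod (s b)))
    (fun b c (f : hom M b c) => layer_map f) layer_map_id layer_map_comp
    layer_map_linearl.

End Functor.

Lemma trivial_layer_subproof (s : layers) b :
  lin_closed ([set 0] : {set F b}) /\ {subset [set 0] <= top (s b)}.
Proof.
split; first split.
- by rewrite inE.
- by move=> k x y; rewrite !inE => /eqP-> /eqP->; rewrite scaler0 addr0.
- by move=> x; rewrite inE => /eqP ->; case: (top_closed (s b)).
Qed.

Definition top_layer (s : layers) b : layer (F b) :=
  Layer (top_closed (s b)) (trivial_layer_subproof s b).1
    (trivial_layer_subproof s b).2.

Lemma top_layer_bot_map (s : layers) b c (f : hom M b c) x :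
  x \in bot (top_layer s b) -> fmap F f x \in bot (top_layer s c).
Proof. by rewrite !inE => /eqP ->; rewrite linear0. Qed.

Definition top_layers (s : layers) : layers :=
  Layers (layer_at := top_layer s) (@layer_top_map s) (@top_layer_bot_map s).

Lemma layer_subquotient (s : layers) : subquotient (layer_functor s) F.
Proof.
pose H := layer_functor (top_layers s).
have val_clsH b u : u \in top (s b) -> layer_val (cls (top_layers s b) u) = u.
  by move=> ut; have := cls_val_sub (s := top_layers s b) ut; rewrite inE subr_eq0 => /eqP.
have i_lin b : linear (fun q : layer_mod (top_layers s b) => layer_val q).
  move=> k; elim/cls_ind => u ut; elim/cls_ind => w wt.
  rewrite -cls_lin // !val_clsH //.
  by have [_ tP] := top_closed (s b); apply: tP.
pose i b : {linear H b -> F b} :=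
  HB.pack (fun q : H b => layer_val (q : layer_mod (top_layers s b)))
    (GRing.isLinear.Build A (H b) (F b) *:%R _ (i_lin b)).
have p_lin b : linear (fun q : layer_mod (top_layers s b) => cls (s b) (layer_val q)).
  move=> k q r; rewrite -cls_lin; last first.
  - exact: (layer_val_top r).
  - exact: (layer_val_top q).
  by congr cls; apply: i_lin.
pose p b : {linear H b -> layer_functor s b} :=
  HB.pack (fun q : H b => cls (s b) (layer_val (q : layer_mod (top_layers s b)))
     : layer_functor s b)
    (GRing.isLinear.Build A (H b) (layer_functor s b) *:%R _ (p_lin b)).
have i_nat b c (f : hom M b c) x : i c (fmap H f x) = fmap F f (i b x).
  rewrite /= /layer_map val_clsH //; apply: layer_top_map; exact: (layer_val_top x).
have p_nat b c (f : hom M b c) x : p c (fmap H f x) = fmap (layer_functor s) f (p b x).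
  rewrite /= layer_map_cls; last exact: (layer_val_top x).
  by congr cls; apply: i_nat.
exists H, (NatTrans i_nat), (NatTrans p_nat); split=> [b x y /val_inj //|b].
elim/cls_ind => u ut; exists (cls (top_layers s b) u).
by rewrite /= val_clsH.
Qed.

End SubquotientFunctor.

(** * Linear relations between functors *)

Section LinearRelations.
Variables (A : comNzRingType) (R : finAlgType A).
Variables (n : nat) (M : 'I_n -> finLmodType R).
Implicit Types (F G : lin_functor M) (b c : obj n).

Record linrel F G := LinRel {
  rel_at :> forall b, F b -> G b -> bool;
  rel0 : forall b, rel_at (0 : F b) (0 : G b);
  rel_lin : forall b (k : A) (x x' : F b) (y y' : G b),
    rel_at x y -> rel_at x' y' -> rel_at (k *: x + x') (k *: y + y');
  rel_map : forall b c (f : hom M b c) x y,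
    rel_at x y -> rel_at (fmap F f x) (fmap G f y)
}.

Lemma relB F G (D : linrel F G) b x x' y y' :
  D b x y -> D b x' y' -> D b (x - x') (y - y').
Proof.
by move=> h h'; rewrite -(scaleN1r x') -(scaleN1r y') addrC [y + _]addrC rel_lin.
Qed.

Section GeneratedRelation.
Variables (F G : lin_functor M) (b : obj n) (x : F b) (y : G b).

Definition gen_rel c (u : F c) (v : G c) : bool :=
  `[< exists f : hom M b c, u = fmap F f x /\ v = fmap G f y >].

Lemma gen_rel0 c : gen_rel (0 : F c) (0 : G c).
Proof. by apply/asboolP; exists \0; rewrite !fmap0. Qed.

Lemma gen_rel_lin c (k : A) (u u' : F c) (v v' : G c) :
  gen_rel u v -> gen_rel u' v' -> gen_rel (k *: u + u') (k *: v + v').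
Proof.
move=> /asboolP[f [-> ->]] /asboolP[g [-> ->]]; apply/asboolP.
have hl : linear (fun z => k%:A *: f z + g z).
  move=> r z w; rewrite !linearP !scalerDr !scalerA addrACA.
  by rewrite mulr_algl mulr_algr.
pose h : hom M b c := HB.pack (fun z => k%:A *: f z + g z)
  (GRing.isLinear.Build R (obj_mod M b) (obj_mod M c) *:%R _ hl).
by exists h; rewrite !(@fmap_linear _ _ _ _ _ _ _ k f g h).
Qed.

Lemma gen_rel_map c d (f : hom M c d) u v :
  gen_rel u v -> gen_rel (fmap F f u) (fmap G f v).
Proof.
move=> /asboolP[g [-> ->]]; apply/asboolP.
by exists (f \o g); rewrite !fmap_comp.
Qed.

Definition generated := LinRel gen_rel0 gen_rel_lin gen_rel_map.

End GeneratedRelation.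

Section Transpose.
Variables (F G : lin_functor M) (D : linrel F G).

Definition transpose : linrel G F :=
  @LinRel G F (fun b y x => D b x y) (rel0 D)
    (fun b k y y' x x' => @rel_lin _ _ D b k x x' y y')
    (fun b c f y x => @rel_map _ _ D b c f x y).

End Transpose.

Lemma functional_rel F G (D : linrel F G) :
    (forall b x, exists y, D b x y) -> (forall b y, D b 0 y -> y = 0) ->
  exists t : nat_trans F G, forall b x, D b x (t b x).
Proof.
move=> tot single.
have uniq_y b x y y' : D b x y -> D b x y' -> y = y'.
  move=> h h'; apply/eqP; rewrite -subr_eq0; apply/eqP/single.
  by rewrite -(subrr x); apply: relB.
pose h b x := xchoose (tot b x).
have hP b x : D b x (h b x) by apply: xchooseP.
have hl b : linear (h b).
  by move=> k x x'; apply: uniq_y (hP _ _) _; apply: rel_lin.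
pose t b : {linear F b -> G b} := HB.pack (h b) (GRing.isLinear.Build A (F b) (G b) *:%R _ (hl b)).
have t_nat b c (f : hom M b c) x : t c (fmap F f x) = fmap G f (t b x).
  by apply: uniq_y (hP _ _) _; apply: rel_map.
by exists (NatTrans t_nat).
Qed.

(** The relation identifies a subquotient of [F] with one of [G] (Goursat):
    its domain modulo its kernel. *)
Section Goursat.
Variables (F G : lin_functor M) (D : linrel F G).

Let dom b : {set F b} := [set x | [exists y, D b x y]].
Let ker b : {set F b} := [set x | D b x 0].

Let domP b : lin_closed (dom b).
Proof.
split; first by rewrite inE; apply/existsP; exists 0; apply: rel0.
move=> k x x'; rewrite !inE => /existsP[y h] /existsP[y' h'].
by apply/existsP; exists (k *: y + y'); apply: rel_lin.
Qed.

Let kerP b : lin_closed (ker b).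
Proof.
split; first by rewrite inE rel0.
move=> k x x'; rewrite !inE => h h'.
by rewrite -[0](addr0 0) -{1}(scaler0 _ k) rel_lin.
Qed.

Let ker_dom b : {subset ker b <= dom b}.
Proof. by move=> x; rewrite !inE => h; apply/existsP; exists 0. Qed.

Let goursat_at b := Layer (domP b) (kerP b) (@ker_dom b).

Let top_map b c (f : hom M b c) x :
  x \in top (goursat_at b) -> fmap F f x \in top (goursat_at c).
Proof.
rewrite !inE => /existsP[y h]; apply/existsP.
by exists (fmap G f y); apply: rel_map.
Qed.

Let bot_map b c (f : hom M b c) x :
  x \in bot (goursat_at b) -> fmap F f x \in bot (goursat_at c).
Proof. by rewrite !inE => h; rewrite -(linear0 (fmap G f)) rel_map. Qed.

Definition goursat_layers : layers F := Layers (layer_at := goursat_at) top_map bot_map.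
Definition goursat : lin_functor M := layer_functor goursat_layers.

Lemma mem_goursat_top b x y : D b x y -> x \in top (goursat_layers b).
Proof. by move=> h; rewrite inE; apply/existsP; exists y. Qed.

Lemma goursat_cls b x y : x \in top (goursat_layers b) ->
  D b (layer_val (cls (goursat_layers b) x)) y = D b x y.
Proof.
move=> xt; have := cls_val_sub xt; rewrite inE => h.
apply/idP/idP => hD.
  have := relB hD h; rewrite subr0; congr (D b _ _).
  by rewrite opprB addrC subrK.
have := rel_lin 1 h hD; rewrite scaler0 add0r; congr (D b _ _).
by rewrite scale1r subrK.
Qed.

(** [F] having no room for a proper subquotient of its own size, the relation
    is then total with trivial kernel. *)
Lemma goursat_full : functor_iso goursat F -> forall b,
  (forall x, exists y, D b x y) /\ (forall x, D b x 0 -> x = 0).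
Proof.
case=> s [t [ts st]] b.
have sI : injective (t b).
  move=> x y e; have := congr1 (fun u : nat_trans _ _ => u b) st => /= stb.
  have stE z : s b (t b z) = z by have := congr1 (fun u : {linear F b -> F b} => u z) stb.
  by rewrite -(stE x) e stE.
have valI : injective (@layer_val _ _ (goursat_layers b)) := val_inj.
have hb : bijective (fun x => layer_val (t b x)).
  by apply: injF_bij => x y /valI /sI.
have val_all x : exists q : layer_mod (goursat_layers b), x = layer_val q.
  by case: hb => g _ gK; exists (t b (g x)); rewrite gK.
split=> x.
  have [q ->] := val_all x; have := layer_val_top q; rewrite inE.
  by move=> /existsP[y h]; exists y.
move=> x0; have [q xq] := val_all x; have [q0 q0E] := val_all 0.
rewrite xq -[q]layer_valK -xq q0E -[in RHS](layer_valK q0) -q0E.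
by congr layer_val; apply: cls_eq; rewrite subr0 inE.
Qed.

End Goursat.

(** By [goursat_full] the relation is total, and distinct elements are related to
    distinct elements; as [F b] is finite, a choice of related elements is then
    bijective, which makes the relation single-valued and onto as well. *)
Lemma rel_automorphism F (D : linrel F F) : functor_iso (goursat D) F ->
  exists s : functor_aut F, forall b x y, D b x y = (y == s b x).
Proof.
move=> iso; have tot b := (goursat_full iso b).1; have inj b := (goursat_full iso b).2.
have onto b : exists2 h : F b -> F b, injective h & forall x, D b x (h x).
  pose h x := xchoose (tot b x).
  have hP x : D b x (h x) by apply: xchooseP.
  exists h => // x x' e; apply/eqP; rewrite -subr_eq0; apply/eqP/(inj b).
  by rewrite -(subrr (h x)) {2}e relB.
have tot' b y : exists x, transpose D b y x.
  have [h hI hP] := onto b; have [g _ gK] := injF_bij hI.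
  by exists (g y); rewrite /= -{2}(gK y).
have single b y : D b 0 y -> y = 0.
  have [h hI hP] := onto b; have [g _ gK] := injF_bij hI.
  have zero x : D b 0 (h x) -> x = 0.
    by move=> h0; apply: inj; have := relB (hP x) h0; rewrite subr0 subrr.
  move=> y0; rewrite -(gK y) (zero (g y)) ?gK // -[RHS](gK 0) (zero (g 0)) //.
  by rewrite gK rel0.
have [t tP] := functional_rel tot single.
have [t' tP'] : exists t' : nat_trans F F, forall b y, D b (t' b y) y.
  by have [|t' tP'] := functional_rel tot' ; [exact: inj | exists t'].
have uniq_y b x y y' : D b x y -> D b x y' -> y = y'.
  move=> h h'; apply/eqP; rewrite -subr_eq0; apply/eqP/(single b).
  by rewrite -(subrr x) relB.
have uniq_x b x x' y : D b x y -> D b x' y -> x = x'.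
  move=> h h'; apply/eqP; rewrite -subr_eq0; apply/eqP/(inj b).
  by rewrite -(subrr y) relB.
have t't : nt_trans t' t = nt_id F.
  by apply: nat_trans_ext => b x; apply: uniq_x (tP' _ _) (tP _ _).
have tt' : nt_trans t t' = nt_id F.
  by apply: nat_trans_ext => b x; apply: uniq_y (tP _ _) (tP' _ _).
exists (FunctorAut t't tt') => b x y; apply/idP/eqP => [h|->]; last exact: tP.
exact: uniq_y h (tP _ _).
Qed.

Section Factorisation.
Variables (K : fieldType) (F G : lin_functor M) (b : obj n).
Local Notation KF F := (KF K F b).

(** Each element of the domain passes to its class in the quotient, and a class to
    the sum of all elements related to it, which does not depend on the chosen
    representative ([goursat_cls]). *)
Lemma goursat_factor (D : linrel F G) :
  exists (p : 'Hom(KF F, KF (goursat D))) (i : 'Hom(KF (goursat D), KF G)),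
    [/\ equivariant p, equivariant i &
        corr K [set p : F b * G b | D b p.1 p.2] = (i \o p)%VF].
Proof.
pose s := goursat_layers D; pose Q := goursat D.
pose Dp : {set F b * Q b} :=
  [set u | (u.1 \in top (s b)) && (cls (s b) u.1 == u.2 :> layer_mod (s b))].
pose Di : {set Q b * G b} :=
  [set u | D b (layer_val (u.1 : layer_mod (s b))) u.2].
have memDp x (q : Q b) :
    ((x, q) \in Dp) = (x \in top (s b)) && (cls (s b) x == q :> layer_mod (s b)).
  by rewrite inE.
have memDi (q : Q b) y : ((q, y) \in Di) = D b (layer_val (q : layer_mod (s b))) y.
  by rewrite inE.
exists (corr K Dp), (corr K Di); split.
- apply: corr_equivariant => f x q; rewrite !memDp => /andP[xt /eqP <-].
  by rewrite (layer_top_map f xt) /= layer_map_cls.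
- apply: corr_equivariant => f q y; rewrite !memDi /=.
  elim/cls_ind: q => u ut h; rewrite layer_map_cls //.
  by rewrite goursat_cls ?layer_top_map // rel_map // -(goursat_cls _ ut).
apply: lfun_ubasis_ext => x; apply/ffunP => y.
rewrite corr_ubasis corr_comp_ubasis inE /=; congr _%:R.
have [h|h] := boolP (D b x y); last first.
  apply/esym/eqP; rewrite cards_eq0 -subset0; apply/subsetP => q.
  rewrite inE memDp memDi => /andP[/andP[xt /eqP <-]].
  by rewrite goursat_cls // (negPf h).
rewrite (_ : [set q | _] = [set cls (s b) x : Q b]) ?cards1 //.
have xt := mem_goursat_top h.
apply/setP => q; rewrite inE memDp memDi xt in_set1 eq_sym /=.
by case: eqP => [->|//]; rewrite goursat_cls.
Qed.

End Factorisation.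

End LinearRelations.

(** * Endomorphisms of KFbar come from automorphisms of F *)

Section CyclicCorrespondences.
Variables (K : fieldType).
Variables (A : comNzRingType) (R : finAlgType A).
Variables (n : nat) (M : 'I_n -> finLmodType R).
Variables (F : lin_functor M) (b : obj n).

Lemma cyclic_sub_generated G (x : functor_sum F G b) :
  (cyclic_sub x : {set F b * G b})
  = [set p | generated x.1 x.2 b p.1 p.2].
Proof.
apply/setP => p; rewrite inE; apply/idP/asboolP.
  move=> /(@cyclic_subP _ _ _ _ (functor_sum F G) b x p)[f ->].
  by exists f.
case=> f [p1 p2]; apply/(@cyclic_subP _ _ _ _ (functor_sum F G) b x p).
by exists f; rewrite [p]surjective_pairing p1 p2.
Qed.

(** The relation generated by [x] has the cyclic submodule of [x] as its value at
    [b], and the two cases are whether the subquotient of Goursat is all of [F]. *)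
Lemma cyclic_corr_dichotomy (x : functor_sum F F b) :
  (exists s : functor_aut F,
     corr K (cyclic_sub x : {set F b * F b}) = aut_act K b s) \/
  (exists G, prec G F /\
     exists (p : 'Hom(KF K F b, KF K G b)) (i : 'Hom(KF K G b, KF K F b)),
     [/\ equivariant p, equivariant i &
         corr K (cyclic_sub x : {set F b * F b}) = (i \o p)%VF]).
Proof.
rewrite cyclic_sub_generated; set D := generated _ _.
have [iso|niso] := pselect (functor_iso (goursat D) F); [left|right].
  have [s sP] := rel_automorphism iso; exists s.
  rewrite /aut_act -corr_graph; congr corr.
  by apply/setP => p; rewrite !inE sP.
exists (goursat D); split; last exact: goursat_factor.
by split=> //; apply: layer_subquotient.
Qed.

End CyclicCorrespondences.

Section Surjectivity.
Variables (K : fieldType) (charK : [pchar K] =i pred0).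
Variables (A : comNzRingType) (R : finAlgType A).
Variables (n : nat) (M : 'I_n -> finLmodType R).
Variables (F : lin_functor M) (b : obj n).

Local Notation V := (KFbar charK F b).
Local Notation KA := (group_algebra K (functor_aut F)).

Lemma end_aut_ext (f g : end_aut charK F b) : end_fun f = end_fun g -> f = g.
Proof. by case: f g => [f fe] [g ge] /= fg; subst g; congr EndAut; apply: Prop_irrelevance. Qed.

Lemma Phi0 : end_fun (Phi charK F b 0) = 0.
Proof.
have := Phi_linear charK b 1 (0 : KA) 0.
rewrite !scale1r addr0 => e; apply: (addrI (end_fun (Phi charK F b 0))).
by rewrite addr0 -e.
Qed.

Theorem Phi_surjective (psi : end_aut charK F b) :
  exists x : KA, Phi charK F b x = psi.
Proof.
have [Vi Vn _] := KFbarP charK F b.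
have [p [pe pV pid]] := equivariant_projection charK Vi.
pose f : 'End(KF K F b) := linfun (vsval \o (psi \o (vsproj V \o p))).
have fE v : f v = vsval (psi (vsproj V (p v))) by rewrite lfunE.
have fe : equivariant f.
  move=> g gb; apply/lfunP => v; rewrite !comp_lfunE !fE.
  have /lfunP/(_ v) := pe g gb; rewrite !comp_lfunE => ->.
  have gV (w : KF K F b) := KFbar_act (charK := charK) gb (v := w).
  have /lfunP/(_ (vsproj V (p v))) := end_equiv psi gb; rewrite !comp_lfunE.
  move=> /(congr1 vsval); rewrite [RHS](restrE _ gV) => <-.
  congr (vsval (psi _)); apply: val_inj.
  by rewrite /= (restrE _ gV) !vsprojK ?gV ?pV.
(* The projection after [h] makes the maps through smaller functors vanish. *)
pose P (h : 'End(KF K F b)) := exists x : KA,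
  forall u : subvs_of V, p (h (vsval u)) = vsval (Phi charK F b x u).
have P0 : P 0 by exists 0 => u; rewrite Phi0 !lfunE /= linear0.
have [] : P f.
  apply: equivariant_span fe => //.
    move=> k h h' [x xP] [x' xP']; exists (k *: x + x') => u.
    by rewrite Phi_linear !add_lfunE !scale_lfunE [LHS]linearP /= xP xP'.
  move=> x; have [[s ->]|[G [GF [q [i [qe ie ->]]]]]] := cyclic_corr_dichotomy K x.
    exists (ga_elt K s) => u; rewrite [RHS]Phi_fun_elt pid //.
    by apply: KFbar_aut_act; apply: subvsP.
  have pi0 : (p \o i)%VF = 0.
    apply: (Vn G GF); first exact: equivariant_comp.
    by apply/subvP => _ /memv_imgP[v _ ->]; rewrite comp_lfunE pV.
  exists 0 => u; rewrite Phi0 comp_lfunE.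
  by have /lfunP/(_ (q (vsval u))) := pi0; rewrite comp_lfunE !lfunE /=.
move=> x xP; exists x; apply: end_aut_ext; apply/lfunP => u; apply: val_inj.
rewrite /= -xP fE pid ?subvsP // pid ?subvsP //.
by congr (vsval (psi _)); apply: val_inj; rewrite /= vsprojK ?subvsP.
Qed.

End Surjectivity.

(** * Objects in which every indecomposable occurs often *)

Section LargeObjects.
Variables (A : comNzRingType) (R : finAlgType A).
Variables (n : nat) (M : 'I_n -> finLmodType R).
Implicit Types (F G H : lin_functor M) (a b c : obj n).

Section Transfer.
Variables (b c : obj n) (i : 'I_n) (t : 'I_(b i)) (s : 'I_(c i)).

(** The summand with index [t] is identified with the one with index [s], both
    being copies of [M i], and the other summands are sent to zero. *)
Definition transfer_fun (x : obj_mod M b) : obj_mod M c :=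
  [ffun m : {j : 'I_n & 'I_(c j)} =>
     dfwith (fun m : {j : 'I_n & 'I_(c j)} => 0 : M (tag m))
       (i := Tagged (fun j => 'I_(c j)) s)
       (x (Tagged (fun j => 'I_(b j)) t)) m].

Lemma transfer_in x :
  transfer_fun x (Tagged (fun j => 'I_(c j)) s) = x (Tagged (fun j => 'I_(b j)) t).
Proof. by rewrite ffunE dfwith_in. Qed.

Lemma transfer_out x m :
  Tagged (fun j => 'I_(c j)) s != m -> transfer_fun x m = 0.
Proof. by move=> sm; rewrite ffunE dfwith_out. Qed.

Lemma transfer_linear : linear transfer_fun.
Proof.
move=> k x y; apply/ffunP => m.
rewrite ![in RHS]ffunE.
have [<-|sm] := eqVneq (Tagged (fun j => 'I_(c j)) s) m.
  by rewrite !transfer_in !ffunE !dfwith_in.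
by rewrite !transfer_out // !dfwith_out // scaler0 addr0.
Qed.
HB.instance Definition _ :=
  GRing.isLinear.Build R (obj_mod M b) (obj_mod M c) _ transfer_fun transfer_linear.

Definition transfer : hom M b c := transfer_fun.

End Transfer.

Lemma transfer_comp b c d (i : 'I_n) (t : 'I_(b i)) (s : 'I_(c i)) (u : 'I_(d i)) :
  (transfer s u \o transfer t s : hom M b d) = transfer t u.
Proof.
apply: linear_ext => x; apply/ffunP => m /=.
have [<-|um] := eqVneq (Tagged (fun j => 'I_(d j)) u) m.
  by rewrite !transfer_in.
by rewrite !transfer_out.
Qed.

Lemma transfer_comp0 b c d (i j : 'I_n) (t : 'I_(b i)) (s : 'I_(c i))
    (s' : 'I_(c j)) (u : 'I_(d j)) :
    Tagged (fun l => 'I_(c l)) s != Tagged (fun l => 'I_(c l)) s' ->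
  forall x, transfer s' u (transfer t s x) = 0.
Proof.
move=> ss' x; apply/ffunP => m /=; rewrite [RHS]ffunE.
have [<-|um] := eqVneq (Tagged (fun j => 'I_(d j)) u) m.
  by rewrite !transfer_in transfer_out.
by rewrite transfer_out.
Qed.

Lemma fmap_transfer_comp F b c d (i : 'I_n) (t : 'I_(b i)) (s : 'I_(c i))
    (u : 'I_(d i)) y :
  fmap F (transfer s u) (fmap F (transfer t s) y) = fmap F (transfer t u) y.
Proof. by rewrite -fmap_comp transfer_comp. Qed.

Lemma fmap_decomposition F b y :
  y = \sum_(k : {i : 'I_n & 'I_(b i)}) fmap F (transfer (tagged k) (tagged k)) y.
Proof.
rewrite -{1}[y]fmap_id; apply: fmap_sum => x; apply/ffunP => m /=.
have sumE (e : seq {i : 'I_n & 'I_(b i)}) :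
    (\sum_(k <- e) transfer (tagged k) (tagged k) x : obj_mod M b) m
    = \sum_(k <- e) (transfer (tagged k) (tagged k) x : obj_mod M b) m.
  elim: e => [|k e IH]; first by rewrite !big_nil ffunE.
  by rewrite !big_cons -IH ffunE.
rewrite sumE (bigD1 m) //= big1 ?addr0 => [|k km].
  by case: m {sumE} => j l; rewrite transfer_in.
by case: k km => j l km; rewrite transfer_out.
Qed.

Section OnceEach.
Variables (a : obj n) (a_gt0 : forall i, (0 < a i)%N).

Definition first_copy i : 'I_(a i) := Ordinal (a_gt0 i).

(** If [a] contains every indecomposable, the identity of any [b] is a sum of maps
    that factor through [a]; hence values at [a] control the whole functor. *)
Lemma fmap_through F b y : y = \sum_(k : {i : 'I_n & 'I_(b i)})
  fmap F (transfer (first_copy (tag k)) (tagged k))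
    (fmap F (transfer (tagged k) (first_copy (tag k))) y).
Proof.
rewrite {1}[y]fmap_decomposition; apply: eq_bigr => k _.
by rewrite fmap_transfer_comp.
Qed.

Lemma nat_trans_determined F G (s t : nat_trans F G) : s a =1 t a -> s = t.
Proof.
move=> st; apply: nat_trans_ext => b x.
rewrite [x]fmap_through !linear_sum; apply: eq_bigr => k _.
by rewrite nt_natural [RHS]nt_natural st.
Qed.

Lemma nat_trans_injective F G (t : nat_trans F G) :
  injective (t a) -> forall b, injective (t b).
Proof.
move=> ta b; apply: raddf_inj => x tx; rewrite [x]fmap_through big1 // => k _.
set u := fmap F _ x; suff -> : u = 0 by rewrite linear0.
by apply: ta; rewrite nt_natural tx !linear0.
Qed.

Lemma nat_trans_surjective F G (t : nat_trans F G) :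
  (forall y, exists x, t a x = y) -> forall b y, exists x, t b x = y.
Proof.
move=> ta b y; have [h hP] := choice ta.
exists (\sum_(k : {i : 'I_n & 'I_(b i)})
  fmap F (transfer (first_copy (tag k)) (tagged k))
    (h (fmap G (transfer (tagged k) (first_copy (tag k))) y))).
rewrite [RHS]fmap_through linear_sum; apply: eq_bigr => k _.
by rewrite nt_natural hP.
Qed.

Lemma nat_trans_inverse F G (t : nat_trans F G) : (forall b, bijective (t b)) ->
  exists t' : nat_trans G F, nt_trans t' t = nt_id F /\ nt_trans t t' = nt_id G.
Proof.
move=> tb; pose t' b : {linear G b -> F b} := sval (cid (linear_inverse (tb b))).
have tK b : cancel (t b) (t' b) by rewrite /t'; case: cid => ? [].
have t'K b : cancel (t' b) (t b) by rewrite /t'; case: cid => ? [].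
have nat b c (f : hom M b c) x : t' c (fmap G f x) = fmap F f (t' b x).
  by apply: (can_inj (tK c)); rewrite t'K nt_natural t'K.
exists (NatTrans nat); split; apply: nat_trans_ext => b x; [exact: tK|exact: t'K].
Qed.

(** Equality of the cardinals at [a] would make both maps of the subquotient
    bijective at [a], hence everywhere. *)
Lemma prec_card F G : prec G F -> (#|G a| < #|F a|)%N.
Proof.
case=> -[H [i [p [iI pS]]]] niso; rewrite ltnNge; apply/negP => FG.
have [r rP] := choice (pS a).
have rI : injective r by apply: can_inj rP.
have GH : (#|G a| <= #|H a|)%N by rewrite -(card_codom rI) max_card.
have HF : (#|H a| <= #|F a|)%N by rewrite -(card_codom (iI a)) max_card.
have pI : injective (p a).
  have [r' _ rK] : bijective r by apply: inj_card_bij rI (leq_trans HF FG).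
  by move=> x y; rewrite -(rK x) -(rK y) !rP => ->.
have ia y : exists x, i a x = y.
  have [i' _ iK] : bijective (i a) by apply: inj_card_bij (iI a) (leq_trans FG GH).
  by exists (i' y).
have ib b : bijective (i b).
  have [i' i'P] := choice (nat_trans_surjective ia (b := b)).
  by exists i' => // x; apply: (iI b); rewrite i'P.
have pb b : bijective (p b).
  have [p' p'P] := choice (pS b).
  by exists p' => // x; apply: (nat_trans_injective pI); rewrite p'P.
have [i' [i'i ii']] := nat_trans_inverse ib.
have [p' [p'p pp']] := nat_trans_inverse pb.
have ev F1 (u v : nat_trans F1 F1) b x : u = v -> u b x = v b x by move=> ->.
case: niso; exists (nt_trans i p'), (nt_trans p i'); split; apply: nat_trans_ext => b x /=.
  have /= -> := @ev _ _ _ b (p' b x) i'i.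
  exact: (@ev _ _ _ b x pp').
have /= -> := @ev _ _ _ b (i' b x) p'p.
exact: (@ev _ _ _ b x ii').
Qed.

End OnceEach.

Section Multiplicity.

Definition single (i : 'I_n) : obj n := fun j => (j == i) : nat.

Definition single_index i : 'I_(single i i).
Proof. by apply: (@Ordinal _ 0); rewrite /single eqxx. Defined.

Lemma single_indexP i (m : {j : 'I_n & 'I_(single i j)}) :
  Tagged (fun j => 'I_(single i j)) (single_index i) = m.
Proof.
case: m => j l; have ji : j = i.
  by move: l; rewrite /single; case: eqP => // _ [].
subst j; congr existT; apply: val_inj => /=.
by case: l => l /=; rewrite /single eqxx; case: l.
Qed.

Lemma fmap_single F i y :
  fmap F (transfer (single_index i) (single_index i)) y = y.
Proof.
rewrite -[RHS]fmap_id; congr (fmap F _ y); apply: linear_ext => x /=.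
by apply/ffunP => m; rewrite -(single_indexP m) transfer_in.
Qed.

(** With at least [#|F (single i)|] copies of each indecomposable, one element
    can carry, in the copies of the [i]-th one, all the elements of a submodule
    that come from that summand; it then generates the submodule. *)
Lemma submodule_cyclic F a (D : {set F a}) :
    (forall i, (0 < a i)%N) -> (forall i, (#|F (single i)| <= a i)%N) ->
  submodule D -> exists x, D = cyclic_sub x.
Proof.
move=> a_gt0 a_ge DP; have [D0 _ Df] := DP.
have Dsum (I : finType) (f : I -> F a) (S : {set F a}) :
    submodule S -> (forall k, f k \in S) -> \sum_k f k \in S.
  move=> SP fS; apply: (big_ind (fun z => z \in S)) => [|x y xS yS|k _].
  - by case: SP.
  - exact: submoduleD SP xS yS.
  - exact: fS.
pose o := single_index; pose j0 := first_copy a_gt0.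
pose Di i : {set F (single i)} := [set z | fmap F (transfer (o i) (j0 i)) z \in D].
pose d (k : {i : 'I_n & 'I_(a i)}) : F (single (tag k)) :=
  nth 0 (enum (Di (tag k))) (tagged k).
have dD k : d k \in Di (tag k).
  rewrite /d; have [h|h] := ltnP (tagged k) (size (enum (Di (tag k)))).
    by rewrite -mem_enum mem_nth.
  by rewrite nth_default // inE linear0.
pose x := \sum_k fmap F (transfer (o (tag k)) (tagged k)) (d k).
have xD : x \in D.
  apply: Dsum => // k; rewrite -(fmap_transfer_comp _ (j0 (tag k))).
  by apply: Df; have := dD k; rewrite inE.
have dx k : fmap F (transfer (tagged k) (o (tag k))) x = d k.
  rewrite linear_sum (bigD1 k) //= big1 ?addr0 => [|l lk].
    by rewrite fmap_transfer_comp fmap_single.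
  rewrite -fmap_comp; apply: fmap0 => y /=; apply: transfer_comp0.
  have tagE (m : {i : 'I_n & 'I_(a i)}) : Tagged (fun j => 'I_(a j)) (tagged m) = m.
    by case: m.
  by rewrite !tagE.
exists x; apply/eqP; rewrite eqEsubset cyclic_sub_min // andbT.
apply/subsetP => y yD; rewrite [y]fmap_decomposition.
apply: Dsum => [|k]; first exact: cyclic_sub_submodule.
rewrite -(fmap_transfer_comp _ (o (tag k))).
set z := fmap F (transfer (tagged k) (o (tag k))) y.
have zD : z \in Di (tag k) by rewrite inE fmap_transfer_comp Df.
have lt_z : (index z (enum (Di (tag k))) < a (tag k))%N.
  apply: leq_trans (a_ge (tag k)); apply: leq_trans (max_card (mem (Di (tag k)))).
  by rewrite cardE index_mem mem_enum.
have <- : d (Tagged (fun j => 'I_(a j)) (Ordinal lt_z)) = z.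
  by rewrite /d /= nth_index // mem_enum.
by rewrite -dx -fmap_comp; apply/cyclic_subP; eexists.
Qed.

End Multiplicity.

End LargeObjects.

(** * Independence of the automorphisms of F on KFbar *)

Lemma span_induction (K : fieldType) (V : vectType K) (X : seq V) (P : V -> Prop) :
    P 0 -> (forall k u v, P u -> P v -> P (k *: u + v)) ->
    (forall x, x \in X -> P x) ->
  forall v, v \in <<X>>%VS -> P v.
Proof.
move=> P0 Plin PX v vX; rewrite (coord_span (X := in_tuple X) vX).
apply: big_rec => // i u _ Pu; apply: Plin => //.
by apply: PX; apply: mem_nth; apply: ltn_ord.
Qed.

Section SmallCorrespondences.
Variables (K : fieldType) (charK : [pchar K] =i pred0).
Variables (A : comNzRingType) (R : finAlgType A).
Variables (n : nat) (M : 'I_n -> finLmodType R).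
Variables (F : lin_functor M) (b : obj n).
Implicit Types G H : lin_functor M.

Lemma pair_submoduleB G H (D : {set functor_sum G H b}) : submodule D ->
  forall p q : G b * H b, p \in (D : {set G b * H b}) ->
    q \in (D : {set G b * H b}) -> p - q \in (D : {set G b * H b}).
Proof. by case. Qed.

Lemma pair_submoduleD G H (D : {set functor_sum G H b}) : submodule D ->
  forall p q : G b * H b, p \in (D : {set G b * H b}) ->
    q \in (D : {set G b * H b}) -> p + q \in (D : {set G b * H b}).
Proof. by move=> DP p q; apply: (submoduleD DP). Qed.

Lemma submodule_comp G H G' (D2 : {set functor_sum H G' b})
    (D1 : {set functor_sum G H b}) :
  submodule D2 -> submodule D1 ->
  submodule (rel_comp (D2 : {set H b * G' b}) (D1 : {set G b * H b})
             : {set functor_sum G G' b}).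
Proof.
move=> P2 P1; have B1 := pair_submoduleB P1; have B2 := pair_submoduleB P2.
have [z1 _ f1] := P1; have [z2 _ f2] := P2.
split.
- rewrite inE; apply/existsP; exists 0; apply/andP; split; [exact: z1|exact: z2].
- move=> [x x'] [y y']; rewrite !inE /= => /existsP[u /andP[xu ux]] /existsP[v /andP[yv vy]].
  apply/existsP; exists (u - v); apply/andP; split.
    exact: (B1 (x, u) (y, v)).
  exact: (B2 (u, x') (v, y')).
- move=> f [x x']; rewrite !inE /= => /existsP[u /andP[xu ux]].
  apply/existsP; exists (fmap H f u); apply/andP; split.
    exact: (f1 f (x, u)).
  exact: (f2 f (u, x')).
Qed.

(** The relations that factor through a set smaller than [F b]; those coming
    from a functor [G] with [prec G F] are among them once [b] contains every
    indecomposable. *)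
Definition small (D : {set F b * F b}) : Prop :=
  submodule (D : {set functor_sum F F b}) /\
  exists (W : finType) (D1 : {set F b * W}) (D2 : {set W * F b}),
    (#|W| < #|F b|)%N /\ D = rel_comp D2 D1.

(** Choosing intermediate elements would embed [F b] in a smaller set. *)
Lemma graph_not_small (h : F b -> F b) : injective h -> ~ small (graph h).
Proof.
move=> hI [_ [W [D1 [D2 [WF hE]]]]].
have mem x : exists w, ((x, w) \in D1) && ((w, h x) \in D2).
  by have : (x, h x) \in graph h by [rewrite inE]; rewrite hE inE => /existsP.
have [w wP] := choice mem.
suff wI : injective w by move: WF; rewrite ltnNge -(card_codom wI) max_card.
move=> x y e; apply: hI; have : (x, h y) \in graph h.
  rewrite hE inE; apply/existsP; exists (w x) => /=.
  have /andP[-> _] := wP x; have /andP[_] := wP y; by rewrite -e.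
by rewrite inE => /eqP.
Qed.

Definition small_span : {vspace 'End(KF K F b)} :=
  <<[seq corr K D | D <- enum [pred D : {set F b * F b} | `[< small D >]]]>>%VS.

Lemma small_corr D : small D -> corr K D \in small_span.
Proof.
by move=> sD; apply/memv_span/map_f; rewrite mem_enum; apply/asboolP.
Qed.

Lemma small_span_factor G (p : 'Hom(KF K F b, KF K G b)) (i : 'Hom(KF K G b, KF K F b)) :
  (#|G b| < #|F b|)%N -> equivariant p -> equivariant i ->
  (i \o p)%VF \in small_span.
Proof.
move=> GF pe ie; move: i ie.
apply: (equivariant_span charK) => [|k u v up vp|y].
- by rewrite comp_lfun0l mem0v.
- by rewrite comp_lfunDl -comp_lfunZl memvD ?memvZ.
move: p pe; apply: (equivariant_span charK) => [|k u v up vp|x].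
- by rewrite comp_lfun0r mem0v.
- by rewrite comp_lfunDr -comp_lfunZr memvD ?memvZ.
have P1 := cyclic_sub_submodule x; have P2 := cyclic_sub_submodule y.
have [k ->] := corr_comp K (pair_submoduleB P1) (pair_submoduleB P2)
  (pair_submoduleD P1) (pair_submoduleD P2).
apply/memvZ/small_corr; split; first exact: submodule_comp.
by exists (G b : finType), (cyclic_sub x), (cyclic_sub y).
Qed.

Lemma small_span_ideal (f t : 'End(KF K F b)) :
  equivariant f -> t \in small_span -> (f \o t)%VF \in small_span.
Proof.
move=> fe; move: t; apply: span_induction => [|k u v up vp|_ /mapP[D + ->]].
- by rewrite comp_lfun0r mem0v.
- by rewrite comp_lfunDr -comp_lfunZr memvD ?memvZ.
rewrite mem_enum => /asboolP[DP [W [D1 [D2 [WF DE]]]]].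
move: f fe; apply: (equivariant_span charK) => [|k u v up vp|x].
- by rewrite comp_lfun0l mem0v.
- by rewrite comp_lfunDl -comp_lfunZl memvD ?memvZ.
have P2 := cyclic_sub_submodule x.
have [k ->] := corr_comp K (pair_submoduleB DP) (pair_submoduleB P2)
  (pair_submoduleD DP) (pair_submoduleD P2).
apply/memvZ/small_corr; split; first exact: submodule_comp.
exists W, D1, (rel_comp (cyclic_sub x : {set F b * F b}) D2); split=> //.
apply/setP => -[u v]; rewrite {}DE !inE /=.
apply/existsP/existsP => -[w /andP[]].
  rewrite inE => /existsP[w' /= /andP[uw' w'w]] wv; exists w'.
  by rewrite uw' inE; apply/existsP; exists w; rewrite w'w.
move=> uw; rewrite inE => /existsP[w' /= /andP[ww' w'v]]; exists w'.
by rewrite w'v andbT inE; apply/existsP; exists w; rewrite uw.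
Qed.

Lemma small_spanP f : f \in small_span ->
  exists2 k : {set F b * F b} -> K, (forall D, ~ small D -> k D = 0) &
    f = \sum_D k D *: corr K D.
Proof.
move: f; apply: span_induction => [|k u v [ku u0 ->] [kv v0 ->]|_ /mapP[D + ->]].
- by exists (fun=> 0) => //; rewrite big1 // => D _; rewrite scale0r.
- exists (fun D => k * ku D + kv D) => [D sD|]; first by rewrite u0 // v0 // mulr0 addr0.
  rewrite scaler_sumr -big_split /=; apply: eq_bigr => D _.
  by rewrite scalerDl scalerA.
rewrite mem_enum => /asboolP sD.
exists (fun D' => (D' == D)%:R) => [D' sD'|].
  by case: eqP => // e; case: sD'; rewrite e.
rewrite (bigD1 D) //= eqxx scale1r big1 ?addr0 // => D' /negPf ->.
by rewrite scale0r.
Qed.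

(** Every equivariant map from KG(b) to KF(b) is von Neumann regular, so the
    maps through smaller functors contain an idempotent whose kernel receives no
    nonzero map from any of them. *)
Lemma small_idempotent : (forall G, prec G F -> (#|G b| < #|F b|)%N) ->
  exists q : 'End(KF K F b),
    [/\ q \in small_span, equivariant q, (q \o q)%VF = q &
        (lker q <= KFbar charK F b)%VS].
Proof.
move=> prec_lt.
pose idem (q : 'End(KF K F b)) :=
  [/\ q \in small_span, equivariant q & (q \o q)%VF = q].
pose Q d := `[< exists2 q, idem q & \dim (limg q) = d >].
have Q0 : exists d, Q d.
  exists 0%N; apply/asboolP; exists 0; last by rewrite lim0g dimv0.
  by split; [exact: mem0v| |exact: comp_lfun0l] => g gb; rewrite comp_lfun0l comp_lfun0r.
have Qub d : Q d -> (d <= \dim (fullv : {vspace KF K F b}))%N.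
  by case/asboolP => q _ <-; apply/dimvS/subvf.
case: (ex_maxnP Q0 Qub) => d /asboolP[q [qS qe qq] <-] qmax; exists q; split=> //.
have [_ _ Vmax] := KFbarP charK F b; apply: Vmax.
  move=> g gb; apply/subvP => _ /memv_imgP[v + ->]; rewrite memv_ker => /eqP qv.
  have /lfunP/(_ v) := qe g gb; rewrite !comp_lfunE memv_ker => ->.
  by rewrite qv linear0.
move=> G GF f fe /subvP fker.
have qf : (q \o f)%VF = 0.
  apply/lfunP => v; rewrite comp_lfunE lfunE /=; apply/eqP.
  by rewrite -memv_ker fker // memv_img ?memvf.
have [g ge fgf] := equivariant_regular charK fe.
(* [r] projects onto the image of [f] and kills that of [q], so that [q + r] is
   an idempotent of larger rank than [q] unless [f] is zero. *)
pose r := (f \o (g \o (\1 - q)))%VF.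
have e1q : equivariant (\1 - q : 'End(KF K F b))%VF.
  rewrite addrC -[X in equivariant (X + _)]scaleN1r.
  exact/equivariantZD/equivariant1.
have ge1 : equivariant (g \o (\1 - q))%VF by apply: equivariant_comp.
have rE v : r v = f (g (v - q v)).
  by rewrite !comp_lfunE add_lfunE opp_lfunE id_lfunE.
have fgfE v : f (g (f v)) = f v.
  by have /lfunP/(_ v) := fgf; rewrite !comp_lfunE.
have qfE v : q (f v) = 0 by have /lfunP/(_ v) := qf; rewrite comp_lfunE lfunE.
have qqE v : q (q v) = q v by have /lfunP/(_ v) := qq; rewrite comp_lfunE.
have rfE v : r (f v) = f v by rewrite rE qfE subr0 fgfE.
pose q' : 'End(KF K F b) := q + r.
have idq' : idem q'.
  split; first by rewrite memvD // small_span_factor // prec_lt.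
    by rewrite /q' -[q]scale1r; apply/equivariantZD/equivariant_comp.
  apply/lfunP => v; rewrite comp_lfunE !add_lfunE !linearD /= qqE.
  by rewrite [r v]rE qfE addr0 rfE [r (q v)]rE qqE subrr !linear0 add0r.
have qq' : (limg q <= limg q')%VS.
  apply/subvP => _ /memv_imgP[v _ ->]; apply/memv_imgP; exists (q v); rewrite ?memvf //.
  by rewrite add_lfunE qqE rE qqE subrr !linear0 addr0.
have eqq' : limg q = limg q'.
  by apply/eqP; rewrite eqEdim qq' qmax //; apply/asboolP; exists q'.
apply/lfunP => v; rewrite lfunE /=.
have : f v \in limg q.
  rewrite eqq'; apply/memv_imgP; exists (f v); rewrite ?memvf //.
  by rewrite add_lfunE qfE rfE add0r.
by case/memv_imgP => w _ e; rewrite e -qqE -e qfE.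
Qed.

End SmallCorrespondences.

Section Injectivity.
Variables (K : fieldType) (charK : [pchar K] =i pred0).
Variables (A : comNzRingType) (R : finAlgType A).
Variables (n : nat) (M : 'I_n -> finLmodType R).
Variables (F : lin_functor M) (a : obj n).
Hypothesis a_gt0 : forall i, (0 < a i)%N.
Hypothesis a_ge : forall i, (#|functor_sum F F (single i)| <= a i)%N.

Local Notation KA := (group_algebra K (functor_aut F)).

Lemma aut_graph_inj (s t : functor_aut F) : graph (s a) = graph (t a) -> s = t.
Proof.
move=> /setP e; apply: functor_aut_ext; suff -> : aut_fun s = aut_fun t by [].
apply: (nat_trans_determined a_gt0) => x; apply/eqP.
by have := e (x, s a x); rewrite !inE /= eqxx => <-.
Qed.

Lemma aut_graph_submodule (s : functor_aut F) :
  submodule (graph (s a) : {set functor_sum F F a}).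
Proof.
split; first by rewrite inE /= linear0.
- move=> [x x'] [y y']; rewrite !inE /= => /eqP-> /eqP->.
  by rewrite linearB.
- move=> f [x x']; rewrite !inE /= => /eqP ->.
  by rewrite nt_natural.
Qed.

(** All submodules are cyclic, so [downset_free] applies to them. *)
Lemma corr_free (k : {set F a * F a} -> K) :
    (forall D, k D != 0 -> submodule (D : {set functor_sum F F a})) ->
    \sum_D k D *: corr K D = 0 ->
  forall D, k D = 0.
Proof.
move=> kS sum0.
pose down (x : F a * F a) : {set F a * F a} := cyclic_sub (x : functor_sum F F a).
pose C := [pred D : {set F a * F a} | `[< submodule (D : {set functor_sum F F a}) >]].
have down_refl x : x \in down x.
  exact (@cyclic_sub_refl _ _ _ _ (functor_sum F F) a x).
apply: (downset_free (down := down) (C := C) down_refl).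
- by move=> D /asboolP/(submodule_cyclic a_gt0 a_ge)[x ->]; exists x.
- by move=> D x /asboolP DP xD; apply: (@cyclic_sub_min _ _ _ _ (functor_sum F F)).
- move=> D; apply: contraNeq => /kS DP; exact/asboolP.
move=> [x y]; have /lfunP/(_ (ubasis K x)) := sum0.
rewrite sum_lfunE => /ffunP/(_ y); rewrite sum_ffunE lfunE /= ffunE => {2}<-.
by apply: eq_bigr => D _; rewrite scale_lfunE ffunE corr_ubasis.
Qed.

Lemma Phi_ker (z : KA) : end_fun (Phi charK F a z) = 0 -> z = 0.
Proof.
move=> Pz.
pose f : 'End(KF K F a) := \sum_(s <- ga_supp z) ga_coef z s *: aut_act K a s.
have fV v : v \in KFbar charK F a -> f v = 0.
  move=> vV; have /lfunP/(_ (vsproj _ v)) := Pz.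
  rewrite lfunE /= /Phi_fun /ga_ext sum_lfunE => /(congr1 vsval) /=.
  rewrite linear_sum /= => e; rewrite /f sum_lfunE -[RHS]e.
  apply: eq_bigr => s _; rewrite !scale_lfunE linearZ /= restrE => [|w].
    by rewrite vsprojK.
  exact: KFbar_aut_act.
have [q [qS qe qq qV]] := small_idempotent charK (prec_card a_gt0 (F := F)).
have fe : equivariant f.
  rewrite /f; apply: big_rec => [g gb|s u _ ue].
    by rewrite comp_lfun0l comp_lfun0r.
  exact/equivariantZD/ue/aut_act_equiv.
have fq : (f \o q)%VF = f.
  apply/lfunP => v; apply/eqP; rewrite comp_lfunE eq_sym -subr_eq0 -linearB.
  apply/eqP/fV/(subvP qV); rewrite memv_ker linearB /=.
  by have /lfunP/(_ v) := qq; rewrite comp_lfunE => ->; rewrite subrr.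
have [k ksmall fE] : exists2 k : {set F a * F a} -> K,
    (forall D, ~ small D -> k D = 0) & f = \sum_D k D *: corr K D.
  by apply: (small_spanP (b := a)); rewrite -fq small_span_ideal.
(* [f] is written with the coefficients [k] in terms of small relations and with
   the coefficients [c] in terms of graphs of automorphisms. *)
pose c D := \sum_(s <- ga_supp z | graph (s a) == D) ga_coef z s.
have cE D : c D = k D.
  apply/eqP; rewrite -subr_eq0; apply/eqP.
  apply: (corr_free (k := fun D => c D - k D)).
    move=> {}D; have [[DP _] _ //|ns] := pselect (small D).
    rewrite ksmall // subr0 => cD.
    have [s _ /eqP <-] : exists2 s : functor_aut F, s \in ga_supp z & graph (s a) == D.
      apply/hasP; apply: contraNT cD => /hasPn none.
      by rewrite /c big_seq_cond big1 // => s /andP[/none/negPf ->].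
    exact: aut_graph_submodule.
  under eq_bigr do rewrite scalerBl.
  rewrite sumrB -fE; apply/eqP; rewrite subr_eq0; apply/eqP.
  rewrite /f /c; under eq_bigr do rewrite scaler_suml.
  rewrite (exchange_big_dep xpredT) //=; apply: eq_bigr => s _.
  by rewrite (big_pred1 (graph (s a))) ?corr_graph // => D; rewrite /= eq_sym.
have z0 s : s \in ga_supp z -> ga_coef z s = 0.
  move=> sz; have := cE (graph (s a)).
  rewrite ksmall; last first.
    apply: graph_not_small; exact: can_inj (@aut_funVK _ _ _ _ _ s a).
  rewrite /c -big_filter (_ : [seq t <- _ | _] = [:: s]) ?big_seq1 //.
  rewrite -(filter_pred1_uniq (fset_uniq _) sz).
  apply: eq_filter => t /=; apply/eqP/eqP => [/aut_graph_inj|->] //.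
by rewrite (ga_sum z) big_seq big1 // => s /z0 ->; rewrite scale0r.
Qed.

Theorem Phi_injective : injective (Phi charK F a).
Proof.
move=> x y e; apply/eqP; rewrite -subr_eq0; apply/eqP/Phi_ker.
by rewrite addrC -scaleN1r Phi_linear e scaleN1r addNr.
Qed.

End Injectivity.

(** * The group algebra of Aut F and the endomorphisms of KFbar *)

Theorem theorem2
  (o : idomainType) (pi : o) (Ho : complete_dvr pi)
  (ell : nat) (ell_gt0 : (0 < ell)%N)
  (R : finAlgType (truncation Ho ell_gt0))
  (K : closedFieldType) (charK : [pchar K] =i pred0)
  (n : nat) (M : 'I_n -> finLmodType R)
  (M_indec : forall i, indecomposable (M i))
  (M_noniso : forall i j, i != j -> ~ isomorphic (M i) (M j))
  (F : lin_functor M) :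
  (forall (b : obj n) (psi : end_aut charK F b),
     exists x : group_algebra K (functor_aut F), Phi charK F b x = psi) /\
  (exists2 c : nat, (0 < c)%N &
     forall a : obj n, (forall i, (c < a i)%N) -> injective (Phi charK F a)).
Proof.
split; first exact: Phi_surjective.
(* [submodule_cyclic] asks for as many copies of each indecomposable as
   [F b * F b] has elements when [b] is that indecomposable alone. *)
exists (\max_i #|functor_sum F F (single i)|).+1 => // a a_gt.
apply: Phi_injective => i; first exact: leq_ltn_trans (a_gt i).
apply: leq_trans (ltnW (a_gt i)); apply: leqW.
exact: (leq_bigmax (F := fun i => #|functor_sum F F (single i)|)).
Qed.
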